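(* Let $0<\alpha<1$ and $0<p<1$ with $p\neq1/2$ be fixed, $q=1-p$, and $h=-p\log p-q\log q$ (with $\log=\log_2$). Let $\xi_1,\dots,\xi_n$ be independent random infinite binary strings with independent bits, each equal to $1$ with probability $p$. Build the $\alpha$-LC trie on them, and let $D_n(\alpha)$ be the depth in this $\alpha$-LC trie of a (uniformly) randomly chosen one of the strings (equivalently, by symmetry, of $\xi_1$). Then $$\frac{D_n(\alpha)}{\log\log n\,\big/\big(-\log\big(1-\frac{h}{\log(1/\sqrt{pq})}\big)\big)}\to1\quad\text{in probability as }n\to\infty.$$
   Context: For a finite set $S$ of binary strings, the $\alpha$-fillup level is $F(S)=\max\{k:\bar X_k\ge\alpha\}$, where $\bar X_k=2^{-k}X_k$ and $X_k$ is the number of words $r\in\{0,1\}^k$ that are a prefix of at least two strings of $S$. The $\alpha$-LC trie of $S$ with $|S|\ge2$ is defined recursively: its root compresses the (uncompressed) trie of $S$ up to level $F(S)$ into a single node; the strings of $S$ are split into groups according to their prefix of length $F(S)+1$, each group (with this prefix removed) forms a child subtree, a group with a single string being an external node and a group with at least two strings being replaced recursively by its own $\alpha$-LC trie. The depth of a string is the number of compressed nodes on the path from the root to the external node containing it. *)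

(* Defs.v *)
(* MathComp / MathComp-Analysis. *)
From HB Require Import structures.
From mathcomp Require Import all_boot all_order all_algebra.
From mathcomp Require Import finmap zify.
From mathcomp Require Import all_classical all_reals all_analysis.

Set Implicit Arguments.
Unset Strict Implicit.
Unset Printing Implicit Defensive.

Import Order.TTheory GRing.Theory Num.Theory.
Import numFieldNormedType.Exports.

Local Open Scope classical_set_scope.
Local Open Scope ring_scope.

Definition bstring := nat -> bool.

HB.instance Definition _ := Choice.copy bstring (nat -> bool).

Definition bprefix (k : nat) (s : bstring) : k.-tuple bool := [tuple s i | i < k].

Definition bdrop (k : nat) (s : bstring) : bstring := fun i => s (k + i)%N.

Definition with_prefix (S : {fset bstring}) (k : nat) (r : k.-tuple bool) :
  {fset bstring} := [fset s in S | bprefix k s == r]%fset.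

Definition below (S : {fset bstring}) (k : nat) (r : k.-tuple bool) :
  {fset bstring} := [fset bdrop k s | s in with_prefix S r]%fset.

Definition level_count (S : {fset bstring}) (k : nat) : nat :=
  #|[pred r : k.-tuple bool | (1 < #|` with_prefix S r|)%N]|.

Definition level_ratio (R : realType) (S : {fset bstring}) (k : nat) : R :=
  2 ^- k * (level_count S k)%:R.

(* The fillup level F(S) is k. *)
Definition is_fillup (R : realType) (alpha : R) (S : {fset bstring}) (k : nat) :
  Prop :=
  alpha <= level_ratio R S k /\
  forall m : nat, alpha <= level_ratio R S m -> (m <= k)%N.

(* LCNode k c is a compressed node whose children c are indexed by the words of
   length k.+1; LCNil marks the words for which there is no child. *)
Inductive lctrie : Type :=
| LCNil
| LCLeaf of bstring
| LCNode (k : nat) of (k.+1.-tuple bool -> lctrie).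

HB.instance Definition _ := gen_eqMixin lctrie.
HB.instance Definition _ := gen_choiceMixin lctrie.

Inductive is_lctrie (R : realType) (alpha : R) : {fset bstring} -> lctrie -> Prop :=
| is_lctrie_nil : is_lctrie alpha fset0 LCNil
| is_lctrie_leaf s : is_lctrie alpha [fset s]%fset (LCLeaf s)
| is_lctrie_node S k (c : k.+1.-tuple bool -> lctrie) :
    (1 < #|` S|)%N -> is_fillup alpha S k ->
    (forall w : k.+1.-tuple bool, is_lctrie alpha (below S w) (c w)) ->
    is_lctrie alpha S (LCNode c).

(* The default value is not used when 0 < alpha <= 1: see lctrie_ofP and
   is_lctrie_unique. *)
Definition lctrie_of (R : realType) (alpha : R) (S : {fset bstring}) : lctrie :=
  xget LCNil [set t | is_lctrie alpha S t].

(* Number of compressed nodes met when following s from the root of t. *)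
Fixpoint lcdepth (t : lctrie) (s : bstring) : nat :=
  match t with
  | LCNode k c => (lcdepth (c (bprefix k.+1 s)) (bdrop k.+1 s)).+1
  | _ => 0%N
  end.

Section ExistenceUniqueness.
Variables (R : realType) (alpha : R).
Implicit Types (S : {fset bstring}).

Lemma is_fillup_unique S k m : is_fillup alpha S k -> is_fillup alpha S m -> k = m.
Proof.
move=> [ak mk] [am mm]; apply/eqP.
by rewrite eqn_leq (mk _ am) (mm _ ak).
Qed.

Lemma is_lctrie_inv S t : is_lctrie alpha S t ->
  match t with
  | LCNil => S = fset0
  | LCLeaf s => S = [fset s]%fset
  | LCNode k c => [/\ (1 < #|` S|)%N, is_fillup alpha S k &
                     forall w, is_lctrie alpha (below S w) (c w)]
  end.
Proof. by case. Qed.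

Lemma is_lctrie_unique S t u : is_lctrie alpha S t -> is_lctrie alpha S u -> t = u.
Proof.
move=> tS; elim: tS u => {S t} [ |s|S k c S2 Fk _ IH] [ |s'|k' c'] /is_lctrie_inv //.
- by move=> /fsetP/(_ s'); rewrite !inE eqxx.
- by case; rewrite cardfs0.
- by move=> /fsetP/(_ s); rewrite !inE eqxx.
- by move=> /fsetP/(_ s); rewrite !inE eqxx => /esym/eqP ->.
- by case; rewrite cardfs1.
- by move=> S0; rewrite S0 cardfs0 in S2.
- by move=> S1; rewrite S1 cardfs1 in S2.
move=> [_ Fk' cS]; have E := is_fillup_unique Fk Fk'; subst k'.
by congr LCNode; apply/funext => w; apply: IH.
Qed.

Lemma level_count_le S k : (level_count S k <= #|` S|)%N.
Proof.
rewrite /level_count cardE -(size_map (bprefix k)) uniq_leq_size ?enum_uniq//.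
move=> r; rewrite mem_enum inE => r2.
have /fset0Pn[s] : with_prefix S r != fset0 by rewrite -cardfs_gt0 ltnW.
by rewrite !inE /= => /andP[sS /eqP <-]; apply: map_f.
Qed.

Hypothesis alpha_gt0 : 0 < alpha.
Hypothesis alpha_le1 : alpha <= 1.

Lemma is_fillup_exists S : (1 < #|` S|)%N -> exists k, is_fillup alpha S k.
Proof.
move=> S2.
have F0 : alpha <= level_ratio R S 0.
  rewrite /level_ratio expr0 invr1 mul1r (le_trans alpha_le1)// ler1n.
  apply/card_gt0P; exists [tuple]; rewrite inE.
  suff -> : with_prefix S [tuple] = S by [].
  by apply/fsetP => s; rewrite !inE /= tuple0 [X in _ == X]tuple0 eqxx andbT.
pose N := Num.truncn (#|` S|%:R / alpha : R).
have bnd k : alpha <= level_ratio R S k -> (k <= N)%N.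
  rewrite /level_ratio mulrC ler_pdivlMr ?exprn_gt0// => H.
  rewrite /N; have : (k%:R : R) <= #|` S|%:R / alpha.
    rewrite ler_pdivlMr// mulrC; apply: (@le_trans _ _ (alpha * 2 ^+ k)).
      by rewrite ler_pM2l// -natrX ler_nat ltnW// ltn_expl.
    by rewrite (le_trans H)// ler_nat level_count_le.
  by move=> kS; rewrite truncn_ge_nat// divr_ge0// ltW.
have exP : exists k, alpha <= level_ratio R S k by exists 0%N.
by case: (ex_maxnP exP bnd) => k ak mk; exists k; split.
Qed.

Lemma is_lctrie_exists S : exists t, is_lctrie alpha S t.
Proof.
have sep : exists m, {in S &, injective (bprefix m)}.
  pose dif (st : bstring * bstring) :=
    xget 0%N [set j | st.1 j != st.2 j].
  pose m := \max_(st <- [seq (x, y) | x <- enum_fset S, y <- enum_fset S]) (dif st).+1.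
  exists m => s t sS tS Est; apply: contrapT => /eqP nst.
  have [j jst] : exists j, s j != t j.
    by apply: contrapT => H; case/eqP: nst; apply/funext => j;
      apply: contrapT => /eqP Hj; apply: H; exists j.
  have dst : s (dif (s, t)) != t (dif (s, t)).
    by rewrite /dif; case: xgetP => [i _ //|/(_ j)]; rewrite /= jst.
  have dm : (dif (s, t) < m)%N.
    apply: (@leq_bigmax_seq _ _ xpredT (fun st => (dif st).+1) (s, t)) => //.
    by apply/allpairsP; exists (s, t).
  move: Est => /(congr1 (fun u : m.-tuple bool => tnth u (Ordinal dm))).
  by rewrite !tnth_mktuple /= => /eqP; rewrite (negbTE dst).
case: sep => m; elim/ltn_ind: m S => m IH S inj.
have [S2|S1] := ltnP 1 #|` S|; last first.
  have [-> |[s sS]] := fset_0Vmem S; first by exists LCNil; constructor.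
  exists (LCLeaf s); suff -> : S = [fset s]%fset by constructor.
  apply/esym/eqP; rewrite eqEfcard cardfs1 S1 andbT.
  by apply/fsubsetP => x; rewrite inE => /eqP ->.
have [k Fk] := is_fillup_exists S2.
suff /choice[c Hc] : forall w : k.+1.-tuple bool, exists t, is_lctrie alpha (below S w) t.
  by exists (LCNode c); constructor.
have m0 : (0 < m)%N.
  rewrite lt0n; apply/eqP => m0; move: inj S2; rewrite m0 => inj.
  suff : (#|` S| <= 1)%N by rewrite leqNgt => /negbTE ->.
  have [-> |[s sS]] := fset_0Vmem S; first by rewrite cardfs0.
  rewrite -(cardfs1 s) fsubset_leq_card//; apply/fsubsetP => x xS; rewrite inE.
  by apply/eqP/inj => //; rewrite tuple0 [RHS]tuple0.
move=> w; apply: (IH (m - k.+1)%N); first by lia.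
move=> _ _ /imfsetP[/= s + ->] /imfsetP[/= t + ->].
rewrite !inE /= => /andP[sS /eqP sw] /andP[tS /eqP tw] Est.
congr bdrop; apply: inj => //; apply: eq_from_tnth => i; rewrite !tnth_mktuple.
have [ik|ki] := ltnP i k.+1.
  move: (congr1 (fun u : k.+1.-tuple bool => tnth u (Ordinal ik)) sw).
  by rewrite -tw !tnth_mktuple.
have im : (i - k.+1 < m - k.+1)%N by rewrite ltn_sub2r// (leq_ltn_trans ki).
move: (congr1 (fun u : (m - k.+1).-tuple bool => tnth u (Ordinal im)) Est).
by rewrite !tnth_mktuple /bdrop /= subnKC.
Qed.

Lemma lctrie_ofP S : is_lctrie alpha S (lctrie_of alpha S).
Proof.
have [t tS] := is_lctrie_exists S.
by rewrite /lctrie_of; case: xgetP => [u _ //|/(_ t)]; case.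
Qed.

End ExistenceUniqueness.

Definition log2 (R : realType) (x : R) : R := ln x / ln 2.

Definition entropy (R : realType) (p : R) : R :=
  - p * log2 p - (1 - p) * log2 (1 - p).

Section Probability.
Context (d : measure_display) (T : measurableType d) (R : realType).
Variable P : probability T R.

Definition sigma_of d' (U : measurableType d') (X : T -> U) : set (set T) :=
  preimage_set_system setT X measurable.

Definition mutually_independent (I : choiceType) (F : I -> set (set T)) : Prop :=
  forall (A : {fset I}) (E : I -> set T),
    (forall i, i \in A -> F i (E i)) ->
    P (\bigcap_(i in [set` A]) E i) = (\prod_(i <- A) P (E i))%E.

Definition cvg_in_probability (X : nat -> T -> R) (l : R) : Prop :=
  forall eps : R, 0 < eps ->
    P [set w | eps <= `|X n w - l|] @[n --> \oo] --> 0%E.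

End Probability.

Definition string_at (T : Type) (b : nat -> nat -> T -> bool) (w : T) (i : nat) :
  bstring := fun j => b i j w.

Definition first_strings (T : Type) (b : nat -> nat -> T -> bool) (n : nat) (w : T) :
  {fset bstring} := [fset string_at b w i | i in iota 0 n]%fset.

Definition random_depth (R : realType) (alpha : R) (T : Type)
  (b : nat -> nat -> T -> bool) (J : T -> nat) (n : nat) (w : T) : nat :=
  lcdepth (lctrie_of alpha (first_strings b n w)) (string_at b w (J w)).

(* Main.v *)
Require Import Defs.
From HB Require Import structures.
From mathcomp Require Import all_boot all_order all_algebra.
From mathcomp Require Import finmap zify ring lra.
From mathcomp Require Import all_classical all_reals all_analysis.
Import Order.TTheory GRing.Theory Num.Theory.
Import numFieldNormedType.Exports.
Local Open Scope classical_set_scope.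
Local Open Scope ring_scope.
Set Implicit Arguments.
Unset Strict Implicit.
Unset Printing Implicit Defensive.

(* Follow the string xi_J down the trie and let y_m = ln (n P(v_m)), where v_m is
   its prefix of length m, so that e^(y_m) is about the number of strings below
   v_m.  Let lam be the mean cost of a fair bit and h that of a p-biased bit, a
   bit costing -ln of its probability.  Words of length k chosen uniformly have
   probability about e^(-lam k), so the fillup level below v_m is about
   y_m / lam, and passing through the corresponding compressed node costs
   xi_J about h y_m / lam.  Hence each node multiplies y by about
   1 - h / lam = kappa, and it takes ln (ln n) / -ln kappa nodes to bring y from
   ln n to a constant.
     Given v_m, each of these approximations fails with probability at most
   K e^(-c |y_m|): the fillup level by first moments (the fraction of filled
   words is itself an average over a fair word) and exponential tilting, the cost
   by Chernoff's bound.  Along any path the y_m decrease by at least a constant, so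
   these bounds sum to O(e^(-c y0)) over all m with |y_m| >= y0.  Thus y0 can be
   taken constant, and the depth spent where |y_m| < y0 is O(1). *)

(** * Expectation functionals *)

(** The fillup levels depend on the whole sample, so the levels of the path at which nodes start are
    random. Bad events are therefore defined at every level m of the path, whether or not a node
    starts there. A union over the n strings would be too costly: only the path of the followed
    string is examined, and the other strings enter through counts that are independent of it once
    v_m is given. The failure bounds are summed over m for each fixed path and averaged only
    afterwards. The estimates concern strings cut to M bits and use elementary expectation
    functionals on finite words; [words_law] carries them over to [P]. The length M may depend on n
    and is taken so large that the cut strings are distinct with high probability, whereas y0 must
    be fixed before n. *)

Section Expectation.
Variable R : realType.

(* An expectation over the points of A satisfying D; points outside D have
   probability 0. *)
Record expectation (A : Type) (D : pred A) (E : (A -> R) -> R) : Prop := {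
  expectation_linear : forall c f g,
    E (fun x => c * f x + g x) = c * E f + E g;
  expectation_le : forall f g, (forall x, D x -> f x <= g x) -> E f <= E g;
  expectation_one : E (fun=> 1) = 1 }.

Section Theory.
Context (A : Type) (D : pred A) (E : (A -> R) -> R) (exE : expectation D E).

Lemma expectation_eq f g : (forall x, D x -> f x = g x) -> E f = E g.
Proof.
move=> fg; apply/eqP; rewrite eq_le.
by apply/andP; split; apply: (expectation_le exE) => x /fg ->.
Qed.

Lemma expectation_zero : E (fun=> 0) = 0.
Proof.
have := expectation_linear exE (-1) (fun=> 1) (fun=> 1).
by rewrite (expectation_one exE) mulr1 addNr.
Qed.

Lemma expectation_scale c f : E (fun x => c * f x) = c * E f.
Proof.
rewrite -[RHS]addr0 -expectation_zero -(expectation_linear exE).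
by apply: expectation_eq => x _; rewrite /= addr0.
Qed.

Lemma expectation_add f g : E (fun x => f x + g x) = E f + E g.
Proof.
rewrite -[E f]mul1r -(expectation_linear exE).
by apply: expectation_eq => x _; rewrite /= mul1r.
Qed.

Lemma expectation_cst c : E (fun=> c) = c.
Proof.
rewrite -[RHS]mulr1 -(expectation_one exE) -expectation_scale.
by apply: expectation_eq => x _; rewrite /= mulr1.
Qed.

Lemma expectation_ge0 f : (forall x, D x -> 0 <= f x) -> 0 <= E f.
Proof. by move=> f0; rewrite -expectation_zero; exact: (expectation_le exE). Qed.

Lemma expectation_sum (I : Type) (r : seq I) (f : I -> A -> R) :
  E (fun x => \sum_(i <- r) f i x) = \sum_(i <- r) E (f i).
Proof.
elim: r => [|i r IH].
  by rewrite big_nil -[RHS]expectation_zero; apply: expectation_eq => x _; rewrite big_nil.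
rewrite big_cons -IH -expectation_add.
by apply: expectation_eq => x _; rewrite big_cons.
Qed.

Lemma markov (f : A -> R) (a : R) : 0 < a -> (forall x, D x -> 0 <= f x) ->
  E (fun x => (a <= f x)%R%:R) <= a^-1 * E f.
Proof.
move=> a0 f0; rewrite -expectation_scale; apply: (expectation_le exE) => x Dx.
have [afx|_] := leP a (f x); last by rewrite mulr0n mulr_ge0 ?invr_ge0 ?f0// ltW.
by rewrite ler_pdivlMl// mulr1.
Qed.

End Theory.

(** Independence is built in by nesting: [iid (iid (coin p) M) N] averages over [N] independent
    words of [M] independent biased bits. *)
Fixpoint iid (A : Type) (E : (A -> R) -> R) (n : nat) (F : seq A -> R) : R :=
  if n is n'.+1 then E (fun x => iid E n' (fun s => F (x :: s))) else F [::].

Definition sample_of (A : Type) (D : pred A) (n : nat) : pred (seq A) :=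
  fun s => (size s == n) && all D s.

Section Iid.
Context (A : Type) (D : pred A) (E : (A -> R) -> R) (exE : expectation D E).

Lemma iid_expectation n : expectation (sample_of D n) (iid E n).
Proof.
elim: n => [|n IH].
  by split => //= f g; apply.
split => [c f g|f g fg|] /=.
- rewrite -(expectation_linear exE).
  by apply: (expectation_eq exE) => x _; rewrite (expectation_linear IH).
- apply: (expectation_le exE) => x Dx; apply: (expectation_le IH) => s Ds.
  by apply: fg; rewrite /sample_of /= eqSS Dx.
- rewrite -[RHS](expectation_one exE).
  by apply: (expectation_eq exE) => x _; rewrite (expectation_one IH).
Qed.

Lemma iid_cat m n F :
  iid E (m + n) F = iid E m (fun s => iid E n (fun t => F (s ++ t))).
Proof.
elim: m F => [//|m IH] F /=.
by apply: (expectation_eq exE) => x _; rewrite IH.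
Qed.

Lemma iid_take_drop m n (F : seq A -> seq A -> R) :
  iid E (m + n) (fun s => F (take m s) (drop m s)) =
  iid E m (fun s => iid E n (F s)).
Proof.
rewrite iid_cat; apply: (expectation_eq (iid_expectation m)) => s /andP[/eqP sm _].
apply: (expectation_eq (iid_expectation n)) => t _.
by rewrite -sm take_size_cat// drop_size_cat.
Qed.

Lemma iid_take m n F : (m <= n)%N -> iid E n (fun s => F (take m s)) = iid E m F.
Proof.
move=> /subnKC <-; rewrite (iid_take_drop m _ (fun s _ => F s)).
apply: (expectation_eq (iid_expectation m)) => s _.
by rewrite (expectation_cst (iid_expectation _)).
Qed.

Lemma iid_prod n (g : A -> R) : iid E n (fun s => \prod_(x <- s) g x) = E g ^+ n.
Proof.
elim: n => [|n IH] /=; first by rewrite big_nil.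
rewrite exprS mulrC -IH -(expectation_scale exE).
apply: (expectation_eq exE) => x _.
rewrite mulrC -(expectation_scale (iid_expectation n)).
by apply: (expectation_eq (iid_expectation n)) => s _; rewrite big_cons.
Qed.

Lemma iid_sum n (g : A -> R) : iid E n (fun s => \sum_(x <- s) g x) = n%:R * E g.
Proof.
elim: n => [|n IH] /=; first by rewrite big_nil mul0r.
rewrite -natr1 mulrDl mul1r addrC -IH.
transitivity (E (fun x => g x + iid E n (fun s => \sum_(y <- s) g y))).
  apply: (expectation_eq exE) => x _.
  rewrite -[in RHS](expectation_cst (iid_expectation n) (g x)).
  rewrite -(expectation_add (iid_expectation n)).
  by apply: (expectation_eq (iid_expectation n)) => s _; rewrite big_cons.
by rewrite (expectation_add exE) (expectation_cst exE).
Qed.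

Lemma iid_count n (Q : pred A) :
  iid E n (fun s => (count Q s)%:R) = n%:R * E (fun x => (Q x)%:R).
Proof.
rewrite -iid_sum; apply: (expectation_eq (iid_expectation n)) => s _.
elim: s => [|x s IH]; first by rewrite big_nil.
by rewrite big_cons -IH /= natrD.
Qed.

Lemma iid_has_le n (Q : pred A) :
  iid E n (fun s => (has Q s)%:R) <= n%:R * E (fun x => (Q x)%:R).
Proof.
rewrite -iid_count; apply: (expectation_le (iid_expectation n)) => s _.
by rewrite has_count; case: (count Q s) => [|k] //=; rewrite ler_nat.
Qed.

(* Markov's inequality for 2^-count, whose expectation is (1 - E Q / 2)^n. *)
Lemma iid_count_le1 n (Q : pred A) :
  iid E n (fun s => (count Q s <= 1)%N%:R) <=
  2 * expR (- (n%:R * E (fun x => (Q x)%:R) / 2)).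
Proof.
pose g x : R := if Q x then 2^-1 else 1.
have Eg : E g = 1 - E (fun x => (Q x)%:R) / 2.
  transitivity (E (fun x => - 2^-1 * (Q x)%:R + 1)).
    apply: (expectation_eq exE) => x _; rewrite /g.
    by case: (Q x); rewrite /= ?mulr0 ?mulr1; lra.
  by rewrite (expectation_linear exE) (expectation_one exE); lra.
have g0 x : 0 <= g x by rewrite /g; case: ifP.
apply: (@le_trans _ _ (2 * iid E n (fun s => \prod_(x <- s) g x))).
  rewrite -(expectation_scale (iid_expectation n)).
  apply: (expectation_le (iid_expectation n)) => s _.
  have -> : \prod_(x <- s) g x = 2^-1 ^+ count Q s.
    elim: s => [|x s IH]; first by rewrite big_nil expr0.
    by rewrite big_cons IH /g /=; case: (Q x); rewrite ?mul1r ?exprS.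
  case: leqP => [|_]; last by rewrite mulr_ge0// exprn_ge0.
  case: (count Q s) => [|[|]]//= _; last first.
    by rewrite expr1 divff.
  by rewrite expr0 mulr1 ler1n.
rewrite iid_prod ler_pM2l// -mulrA -mulrN expRM_natl.
apply: lerXn2r; rewrite ?nnegrE ?expR_ge0//.
  by rewrite (expectation_ge0 exE).
by rewrite Eg expR_ge1Dx.
Qed.

End Iid.

(** Fubini's theorem for two functionals. It lets the average over a sample pass inside the average
    over a fair word that defines a fill ratio. *)
Definition commuting (A B : Type) (E : (A -> R) -> R) (L : (B -> R) -> R) :=
  forall F : A -> B -> R, E (fun x => L (F x)) = L (fun y => E (fun x => F x y)).

Lemma iid_commuting (A B : Type) (DA : pred A) (DB : pred B) E L n :
  expectation DA E -> expectation DB L -> commuting E L ->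
  commuting (@iid A E n) L.
Proof.
move=> exE exL EL; elim: n => [//|n IH] F /=.
rewrite -EL; apply: (expectation_eq exE) => x _.
exact: (IH (fun s => F (x :: s))).
Qed.

Definition coin (p : R) (f : bool -> R) : R := p * f true + (1 - p) * f false.

Lemma coin_expectation p : 0 <= p <= 1 -> expectation predT (coin p).
Proof.
move=> /andP[p0 p1]; split => [c f g|f g fg|]; rewrite /coin; [ring| |ring].
by rewrite lerD// ler_wpM2l ?subr_ge0 ?fg.
Qed.

Lemma coin_commuting p B (DB : pred B) L : expectation DB L -> commuting (coin p) L.
Proof.
move=> exL F; rewrite /coin.
by rewrite -(expectation_scale exL (1 - p)) -(expectation_linear exL).
Qed.

End Expectation.

(** * Tail estimates for Bernoulli words *)

Section Words.
Variable R : realType.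
Implicit Types (p r alpha rho mu : R) (z w : seq bool).

Lemma iid_coin_expectation r n : 0 <= r <= 1 ->
  expectation (sample_of predT n) (iid (coin r) n).
Proof. by move=> r01; apply: iid_expectation; exact: coin_expectation. Qed.

Definition cost p (b : bool) : R := - ln (if b then p else 1 - p).

Definition self_info p z : R := \sum_(b <- z) cost p b.

Lemma self_info_cat p z w : self_info p (z ++ w) = self_info p z + self_info p w.
Proof. by rewrite /self_info big_cat. Qed.

Lemma cost_gt0 p b : 0 < p < 1 -> 0 < cost p b.
Proof.
move=> /andP[p0 p1]; rewrite /cost oppr_gt0.
by apply: ln_lt0; case: b; rewrite ?p0 ?p1//; apply/andP; split; lra.
Qed.

Lemma self_info_ge p c z : (forall b, c <= cost p b) -> c * (size z)%:R <= self_info p z.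
Proof.
move=> cp; elim: z => [|b z IH]; first by rewrite /self_info big_nil mulr0.
by rewrite /self_info big_cons /= -add1n natrD mulrDr mulr1 lerD.
Qed.

Lemma self_info_take_le p z k m : 0 < p < 1 -> (k <= m)%N ->
  self_info p (take k z) <= self_info p (take m z).
Proof.
move=> p01 km; rewrite -[in leRHS](cat_take_drop k (take m z)) self_info_cat.
rewrite take_takel// lerDl sumr_ge0// => b _.
exact/ltW/cost_gt0.
Qed.

Lemma iid_coin_prefix p M z : 0 < p < 1 -> (size z <= M)%N ->
  iid (coin p) M (fun w => (prefix z w)%:R) = expR (- self_info p z).
Proof.
move=> p01; have /andP[p0 p1] := p01.
have p01' : 0 <= p <= 1 by rewrite !ltW.
elim: z M => [|b z IH] [|M]//=.
- by rewrite /self_info big_nil oppr0 expR0.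
- move=> _; rewrite /self_info big_nil oppr0 expR0.
  rewrite -[RHS](expectation_one (coin_expectation p01')).
  apply: (expectation_eq (coin_expectation p01')) => x _.
  exact: expectation_one (iid_coin_expectation M p01').
rewrite ltnS => zM; rewrite /self_info big_cons opprD expRD -(IH M zM) /cost opprK.
have ex := iid_coin_expectation M p01'.
rewrite lnK; last by rewrite posrE; case: (b); lra.
case: b; rewrite /coin /=.
  by rewrite (expectation_zero ex) mulr0 addr0.
by rewrite (expectation_zero ex) mulr0 add0r.
Qed.

Lemma iid_coin_prefix_le p M z : 0 < p < 1 ->
  iid (coin p) M (fun w => (prefix z w)%:R) <= expR (- self_info p z).
Proof.
move=> p01; have [zM|zM] := leqP (size z) M; first by rewrite iid_coin_prefix.
have p01' : 0 <= p <= 1 by case/andP: p01 => ? ?; rewrite !ltW.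
have ex := iid_coin_expectation M p01'.
rewrite (_ : iid _ _ _ = 0) ?expR_ge0//.
rewrite -[RHS](expectation_zero ex); apply: (expectation_eq ex) => w.
move=> /andP[/eqP wM _]; rewrite prefixE; case: eqP => // /(congr1 size).
by rewrite size_take wM ltnNge ltnW//= => wz; rewrite -wz ltnn in zM.
Qed.

Lemma iid_coin_mgf r (f : bool -> R) k : 0 <= r <= 1 ->
  iid (coin r) k (fun s => expR (\sum_(b <- s) f b)) =
  coin r (fun b => expR (f b)) ^+ k.
Proof.
move=> r01; rewrite -(iid_prod (coin_expectation r01)).
apply: (expectation_eq (iid_coin_expectation k r01)) => s _.
by rewrite expR_sum.
Qed.

(** Since 1 - x <= e^(-x), it suffices that (1 - x)(1 + x + 2x^2) - 1 = x^2 (1 - 2x) is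
    nonnegative. *)
Lemma expR_le_quadratic (x : R) : x <= 2^-1 -> expR x <= 1 + x + 2 * x ^+ 2.
Proof.
move=> x2; have x1 : 0 < 1 - x by lra.
have : expR x <= (1 - x)^-1.
  rewrite -[expR x]invrK -expRN lef_pV2 ?posrE ?expR_gt0//.
  by rewrite -[leLHS]/(1 + - x) expR_ge1Dx.
move/le_trans; apply; rewrite -div1r ler_pdivrMr//.
rewrite -subr_ge0 (_ : _ - 1 = x ^+ 2 * (1 - 2 * x)); last by ring.
by rewrite mulr_ge0 ?sqr_ge0//; lra.
Qed.

(** For small s the left side is 1 + s E f + O(s^2), which stays below 1 + s mu because E f < mu.
    The bound s <= 1 serves [expRN_le_rpow] and [min1_expR_le]. *)
Lemma coin_mgf_le r (f : bool -> R) mu : 0 <= r <= 1 -> coin r f < mu ->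
  exists s, 0 < s <= 1 /\ coin r (fun b => expR (s * f b)) <= expR (s * mu).
Proof.
move=> r01 fmu; have ex := coin_expectation r01.
pose B := 1 + `|f true| + `|f false|.
have B1 : 1 <= B by rewrite /B -addrA lerDl addr_ge0.
have fB b : `|f b| <= B.
  have := normr_ge0 (f true); have := normr_ge0 (f false).
  by rewrite /B; case: b; lra.
(* The first bound gives |s f b| <= 1/2, as the quadratic estimate requires; the second fits its
   error into the gap between the mean and mu. *)
pose s := Num.min (2 * B)^-1 ((mu - coin r f) / (2 * B ^+ 2)).
have B0 : 0 < B by lra.
have s0 : 0 < s by rewrite lt_min !divr_gt0 ?invr_gt0 ?mulr_gt0 ?exprn_gt0 ?subr_gt0.
have sB : s * B <= 2^-1.
  have sB : s <= (2 * B)^-1 by rewrite ge_min lexx.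
  by apply: (le_trans (ler_wpM2r (ltW B0) sB)); rewrite invfM -mulrA mulVf ?mulr1// gt_eqF.
have sm : s * (2 * B ^+ 2) <= mu - coin r f.
  by rewrite -ler_pdivlMr ?mulr_gt0 ?exprn_gt0// ge_min lexx orbT.
exists s; split; first by rewrite s0 /=; nra.
apply: (le_trans _ (expR_ge1Dx _)).
apply: (@le_trans _ _ (coin r (fun b => s * f b + (1 + 2 * (s * B) ^+ 2)))).
  apply: (expectation_le ex) => b _.
  have := fB b; rewrite ler_norml => /andP[f1 f2].
  apply: (le_trans (expR_le_quadratic _)); first by nra.
  have : (s * f b) ^+ 2 <= (s * B) ^+ 2.
    have : - (s * B) <= s * f b <= s * B by rewrite -mulrN !ler_pM2l// f1.
    by case/andP=> ? ?; rewrite -subr_ge0 subr_sqr mulr_ge0//; lra.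
  lra.
rewrite (expectation_linear ex) (expectation_cst ex).
suff : 2 * (s * B) ^+ 2 <= s * (mu - coin r f) by lra.
by rewrite exprMn expr2 -!mulrA mulrCA ler_pM2l// mulrCA.
Qed.

Lemma iid_coin_mgf_le r (f : bool -> R) mu k : 0 <= r <= 1 ->
  coin r (fun b => expR (f b)) <= expR mu ->
  iid (coin r) k (fun s => expR (\sum_(b <- s) f b)) <= expR (k%:R * mu).
Proof.
move=> r01 fmu; rewrite iid_coin_mgf// expRM_natl lerXn2r ?nnegrE ?expR_ge0//.
by apply: (expectation_ge0 (coin_expectation r01)) => b _; rewrite expR_ge0.
Qed.

(** The tilt s is taken for the midpoint nu of the mean and mu; the other half of the gap becomes
    the rate s (mu - nu). *)
Lemma chernoff r (f : bool -> R) mu : 0 <= r <= 1 -> coin r f < mu ->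
  exists2 c, 0 < c & forall k,
    iid (coin r) k (fun s => (k%:R * mu <= \sum_(b <- s) f b)%R%:R) <=
    expR (- (c * k%:R)).
Proof.
move=> r01 fmu; pose nu := (coin r f + mu) / 2.
have [s [/andP[s0 s1] sf]] : exists s, 0 < s <= 1 /\
    coin r (fun b => expR (s * f b)) <= expR (s * nu).
  by apply: coin_mgf_le => //; rewrite /nu; lra.
exists (s * (mu - nu)) => [|k]; first by rewrite mulr_gt0//; rewrite /nu; lra.
have ex := iid_coin_expectation k r01.
apply: (@le_trans _ _ (expR (- (k%:R * (s * mu))) *
    iid (coin r) k (fun z => expR (\sum_(b <- z) s * f b)))).
  rewrite -(expectation_scale ex); apply: (expectation_le ex) => z _.
  rewrite -expRD; case: (leP _ (\sum_(b <- z) f b)) => [fz|_]; last exact: expR_ge0.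
  rewrite -[leLHS]expR0 ler_expR -big_distrr /= addrC subr_ge0 mulrCA.
  by rewrite ler_pM2l.
apply: (le_trans (ler_wpM2l (expR_ge0 _) (iid_coin_mgf_le k r01 sf))).
by rewrite -expRD ler_expR le_eqVlt; apply/orP; left; apply/eqP; ring.
Qed.

(** Here s x <= max(x, 0) <= e^x. This lemma and the next trade a sharper bound for an exponential
    of a multiple of x, whose average over a fair word is a moment generating function. *)
Lemma expRN_le_rpow (x s : R) : 0 <= s <= 1 -> expR (- expR x) <= expR (- (s * x)).
Proof.
move=> /andP[s0 s1]; rewrite ler_expR lerN2.
have [x0|x0] := leP x 0.
  by apply: (@le_trans _ _ 0); rewrite ?expR_ge0// mulr_ge0_le0.
have := expR_ge1Dx x; nra.
Qed.

Lemma min1_expR_le (x s : R) : 0 <= s <= 1 -> Num.min 1 (expR x) <= expR (s * x).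
Proof.
move=> /andP[s0 s1]; rewrite ge_min; have [x0|x0] := leP x 0.
  by rewrite orbC ler_expR; apply/orP; left; nra.
by rewrite -[X in X <= _]expR0 ler_expR mulr_ge0// ltW.
Qed.

Let fair_ge0 : 0 <= (2^-1 : R) <= 1. Proof. by apply/andP; split; lra. Qed.

(** Markov's inequality is applied, with threshold 1 - alpha, to the fraction of words z with at
    most one string below v z. Its mean is at most the fair average of 2 exp(- N P(v z) / 2).
    Tilting by s leaves exp(s (k mu - y)) up to a constant, and k <= rho y gives the rate s (1 - rho
    mu). *)
Lemma fillup_lower_tail p alpha rho mu : 0 < p < 1 -> alpha < 1 ->
  0 < rho -> coin 2^-1 (cost p) < mu -> rho * mu < 1 ->
  exists c K, [/\ 0 < c, 0 <= K & forall M N k v, (0 < N)%N ->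
    (size v + k <= M)%N -> k%:R <= rho * (ln N.+1%:R - self_info p v) ->
    iid (iid (coin p) M) N (fun ws => (iid (coin 2^-1) k
      (fun z => (1 < count (prefix (v ++ z)) ws)%N%:R) < alpha)%R%:R) <=
    K * expR (- (c * (ln N.+1%:R - self_info p v)))].
Proof.
move=> p01 a1 rho0 mu_lt rmu1.
have p01' : 0 <= p <= 1 by case/andP: p01 => ? ?; rewrite !ltW.
have [s [/andP[s0 s1] sf]] := coin_mgf_le fair_ge0 mu_lt.
have s01 : 0 <= s <= 1 by rewrite ltW.
have mu0 : 0 < mu.
  apply: le_lt_trans mu_lt; apply: (expectation_ge0 (coin_expectation fair_ge0)).
  by move=> b _; exact/ltW/cost_gt0.
pose K := (1 - alpha)^-1 * (2 * expR (s * ln 4)).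
have K0 : 0 <= K by rewrite !mulr_ge0 ?invr_ge0 ?subr_ge0 ?expR_ge0 ?ltW.
exists (s * (1 - rho * mu)), K; split => //; first by rewrite mulr_gt0 ?subr_gt0.
move=> M N k v N0 vkM; set y := ln N.+1%:R - self_info p v => kry.
have exw := iid_coin_expectation M p01'; have exN := iid_expectation exw N.
have exk := iid_coin_expectation k fair_ge0.
apply: (@le_trans _ _ (iid (iid (coin p) M) N (fun ws => (1 - alpha <=
    iid (coin 2^-1) k (fun z => (count (prefix (v ++ z)) ws <= 1)%N%:R))%R%:R))).
  apply: (expectation_le exN) => ws _; case: ltP => // ua.
  rewrite (_ : iid (coin 2^-1) k (fun z => (count (prefix (v ++ z)) ws <= 1)%N%:R) =
     1 - iid (coin 2^-1) k (fun z => (1 < count (prefix (v ++ z)) ws)%N%:R)).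
    by rewrite lerB ?lexx// ltW.
  apply/eqP; rewrite eq_sym subr_eq -(expectation_add exk) -[X in X == _](expectation_one exk).
  apply/eqP/(expectation_eq exk) => z _.
  by rewrite ltnNge; case: leq; rewrite /= ?addr0 ?add0r.
apply: (le_trans (markov exN _ _)); rewrite ?subr_gt0//.
  by move=> ws _; apply: (expectation_ge0 exk) => z _.
rewrite /K -!mulrA ler_wpM2l ?invr_ge0 ?subr_ge0 ?(ltW a1)//.
rewrite (iid_commuting _ exw exk); last first.
  by apply: (iid_commuting _ (coin_expectation p01') exk); exact: coin_commuting exk.
apply: (@le_trans _ _ (iid (coin 2^-1) k (fun z => 2 * (expR (s * ln 4 - s * y) *
    expR (\sum_(b <- z) s * cost p b))))).
  apply: (expectation_le exk) => z /andP[/eqP zk _].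
  apply: (le_trans (iid_count_le1 exw N _)); rewrite ler_pM2l//.
  rewrite iid_coin_prefix ?size_cat ?zk// self_info_cat.
  rewrite -expRD -big_distrr /= -/(self_info p z).
  (* [ln 4] absorbs the factor 1/2 and the passage from N to N + 1 in y: N / 2 >= (N + 1) / 4. *)
  apply: (@le_trans _ _ (expR (- expR (y - self_info p z - ln 4)))).
    rewrite ler_expR lerN2 expRD expRN lnK ?posrE// ler_pdivlMr// -mulrA.
    rewrite (_ : 4^-1 * 2 = 2^-1 :> R); last by lra.
    rewrite /y -addrA -opprD expRD lnK ?posrE//.
    rewrite [leLHS]mulrAC ler_pM2r ?expR_gt0// ler_pdivrMr//.
    have : 1 <= N%:R :> R by rewrite ler1n.
    by rewrite -natr1 => N1; clear -N1; lra.
  apply: (le_trans (expRN_le_rpow _ s01)).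
  by rewrite ler_expR le_eqVlt; apply/orP; left; apply/eqP; ring.
rewrite !(expectation_scale exk) ler_pM2l//.
apply: (le_trans (ler_wpM2l (expR_ge0 _) (iid_coin_mgf_le k fair_ge0 sf))).
rewrite -!expRD ler_expR.
have : k%:R * (s * mu) <= rho * y * (s * mu) by rewrite ler_wpM2r// mulr_ge0 ?ltW.
lra.
Qed.

(** Some string lies below v z with probability at most min(1, exp(y - self_info z)) <= exp(s (y -
    self_info z)). A fair word of k >= rho y bits rarely costs less than mu k, whence the rate s
    (rho mu - 1). *)
Lemma fillup_upper_tail p alpha rho mu : 0 < p < 1 -> 0 < alpha ->
  0 <= mu -> mu < coin 2^-1 (cost p) -> 1 < rho * mu ->
  exists c K, [/\ 0 < c, 0 <= K & forall M N k v,
    rho * (ln N.+1%:R - self_info p v) <= k%:R ->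
    iid (iid (coin p) M) N (fun ws => (alpha <= iid (coin 2^-1) k
      (fun z => (has (prefix (v ++ z)) ws)%:R))%R%:R) <=
    K * expR (- (c * (ln N.+1%:R - self_info p v)))].
Proof.
move=> p01 a0 mu0 mu_lt rmu1.
have p01' : 0 <= p <= 1 by case/andP: p01 => ? ?; rewrite !ltW.
have : coin 2^-1 (fun b => - cost p b) < - mu.
  by rewrite /coin; rewrite /coin in mu_lt; lra.
move/(coin_mgf_le fair_ge0) => [s [/andP[s0 s1] sf]].
have s01 : 0 <= s <= 1 by rewrite ltW.
exists (s * (rho * mu - 1)), alpha^-1; split; rewrite ?invr_ge0 ?(ltW a0)//.
  by rewrite mulr_gt0 ?subr_gt0.
move=> M N k v; set y := ln N.+1%:R - self_info p v => kry.
have exw := iid_coin_expectation M p01'; have exN := iid_expectation exw N.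
have exk := iid_coin_expectation k fair_ge0.
apply: (le_trans (markov exN a0 _)).
  by move=> ws _; apply: (expectation_ge0 exk) => z _.
rewrite ler_wpM2l ?invr_ge0 ?(ltW a0)//.
rewrite (iid_commuting _ exw exk); last first.
  by apply: (iid_commuting _ (coin_expectation p01') exk); exact: coin_commuting exk.
apply: (@le_trans _ _ (iid (coin 2^-1) k (fun z => expR (s * y) *
    expR (\sum_(b <- z) s * - cost p b)))).
  apply: (expectation_le exk) => z _.
  apply: (@le_trans _ _ (Num.min 1 (expR (y - self_info p z)))).
    rewrite le_min; apply/andP; split.
      rewrite -[leRHS](expectation_one exN); apply: (expectation_le exN) => ws _.
      by case: has.
    apply: (le_trans (iid_has_le exw N _)).
    apply: (le_trans (ler_wpM2l _ (iid_coin_prefix_le _ _ p01))) => //.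
    rewrite self_info_cat /y -addrA -opprD expRD lnK ?posrE//.
    by rewrite ler_pM2r ?expR_gt0// ler_nat.
  apply: (le_trans (min1_expR_le _ s01)).
  by rewrite -expRD ler_expR -big_distrr /= sumrN /self_info; lra.
rewrite (expectation_scale exk).
apply: (le_trans (ler_wpM2l (expR_ge0 _) (iid_coin_mgf_le k fair_ge0 sf))).
rewrite -!expRD ler_expR.
have : rho * y * (s * mu) <= k%:R * (s * mu) by rewrite ler_wpM2r// mulr_ge0 ?(ltW s0).
lra.
Qed.

End Words.

(** * Exceptional samples *)

Section DecreasingSums.
Variable R : realType.

Lemma sum_expR_decreasing (u : nat -> R) (g c y0 : R) M : 0 < g -> 0 < c ->
  (forall m, (m.+1 < M)%N -> u m.+1 <= u m - g) ->
  \sum_(m < M) (y0 <= u m)%R%:R * expR (- (c * u m)) <=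
  expR (- (c * y0)) / (1 - expR (- (c * g))).
Proof.
move=> g0 c0 ug.
have cg1 : expR (- (c * g)) < 1 by rewrite -[ltRHS]expR0 ltr_expR oppr_lt0 mulr_gt0.
pose A := (1 - expR (- (c * g)))^-1.
have A0 : 0 < A by rewrite invr_gt0 subr_gt0.
have AE : A * (1 - expR (- (c * g))) = 1 by rewrite mulVf// gt_eqF// subr_gt0.
(* A potential: if y0 <= u 0, descending from z to u 0 <= z - g releases at least
   [expR (- (c * u 0))], which pays for the first term of the sum. *)
pose phi z := A * (expR (- (c * y0)) - expR (- (c * Num.max z y0))).
have phi_ge0 z : 0 <= phi z.
  by rewrite mulr_ge0 ?(ltW A0)// subr_ge0 ler_expR lerN2 ler_pM2l// le_max lexx orbT.
suff S z : ((0 < M)%N -> u 0%N + g <= z) ->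
    \sum_(m < M) (y0 <= u m)%R%:R * expR (- (c * u m)) <= phi z.
  apply: (le_trans (S (u 0%N + g) _)) => //.
  by rewrite /phi [leRHS]mulrC ler_pM2l// lerBlDr lerDl expR_ge0.
elim: M u ug z => [|M IH] u ug z uz; first by rewrite big_ord0.
rewrite big_ord_recl /=; have {}uz := uz isT.
have {}IH : \sum_(m < M) (y0 <= u m.+1)%R%:R * expR (- (c * u m.+1)) <= phi (u 0%N).
  apply: (IH (fun m => u m.+1)) => [m mM|M0]; first exact: ug.
  by rewrite -lerBrDr ug.
have [y0u|uy0] := leP y0 (u 0%N); last first.
  rewrite mul0r add0r; apply: (le_trans IH).
  by rewrite /phi (max_idPr (ltW uy0)) subrr mulr0 phi_ge0.
rewrite mul1r; apply: (le_trans (lerD (lexx _) IH)).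
have y0z : y0 <= z by rewrite (le_trans y0u)// (le_trans _ uz)// lerDl ltW.
rewrite /phi (max_idPl y0u) (max_idPl y0z).
have : expR (- (c * z)) <= expR (- (c * u 0%N)) * expR (- (c * g)).
  by rewrite -expRD ler_expR -opprD -mulrDr lerN2 ler_pM2l.
rewrite -(ler_pM2l A0); have := congr1 (fun x => x * expR (- (c * u 0%N))) AE.
move: (expR _) (expR _) (expR _) (expR _) => *; lra.
Qed.

(** The previous bound with c = 1 for the sequence read backwards with its sign changed, which again
    decreases by g. *)
Lemma sum_expR_decreasing_neg (u : nat -> R) (g y0 : R) M : 0 < g ->
  (forall m, (m.+1 < M)%N -> u m.+1 <= u m - g) ->
  \sum_(m < M) (u m <= - y0)%R%:R * expR (u m) <=
  expR (- y0) / (1 - expR (- g)).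
Proof.
move=> g0 ug; rewrite (reindex_inj rev_ord_inj) /=.
have ug' m : (m.+1 < M)%N -> - u (M - m.+2)%N <= - u (M - m.+1)%N - g.
  move=> mM; have := ug (M - m.+2)%N.
  have -> : (M - m.+2).+1 = (M - m.+1)%N by lia.
  have mM' : (M - m.+1 < M)%N by lia.
  by move=> /(_ mM'); lra.
have := @sum_expR_decreasing (fun m => - u (M - m.+1)%N) g 1 y0 M g0 ltr01 ug'.
rewrite (mul1r y0) (mul1r g); apply: le_trans.
by apply: ler_sum => m _; rewrite lerNr mul1r opprK.
Qed.

End DecreasingSums.

Section Exceptional.
Context (R : realType) (p alpha : R).
Hypothesis p01 : 0 < p < 1.
Hypothesis alpha01 : 0 < alpha < 1.

Let p01' : 0 <= p <= 1. Proof. by case/andP: p01 => ? ?; rewrite !ltW. Qed.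

Definition fair_frac (k : nat) (Q : pred (seq bool)) : R :=
  iid (coin 2^-1) k (fun z => (Q z)%:R).

(** The y_m of the overview at v. [N] counts the strings other than the followed one, hence
    [N.+1]. *)
Definition log_remaining (N : nat) (v : seq bool) : R :=
  ln N.+1%:R - self_info p v.

Variables rho1 rho2 hm1 hm2 : R.
Hypothesis rho1_gt0 : 0 < rho1.
Hypothesis rho1_lt : rho1 * coin 2^-1 (cost p) < 1.
Hypothesis rho2_gt0 : 0 < rho2.
Hypothesis rho2_gt : 1 < rho2 * coin 2^-1 (cost p).
Hypothesis hm1_lt : hm1 < coin p (cost p).
Hypothesis hm2_gt : coin p (cost p) < hm2.

(** With rho1 < 1 / lam < rho2 these bracket the typical fillup level F: fill_lo <= F < fill_hi. *)
Definition fill_lo (y : R) : nat := Num.truncn (rho1 * y).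
Definition fill_hi (y : R) : nat := (Num.truncn (rho2 * y)).+1.

(* The sample is u :: ws, where u is the word of the string that is followed.  To
   be independent of u, underfull and overfull count words of ws only: two of
   them below v ++ z suffice for a branching there, and one of them is needed. *)
Definition underfull (y : R) v ws :=
  fair_frac (fill_lo y) (fun z => 1 < count (prefix (v ++ z)) ws)%N < alpha.
Definition overfull (y : R) v ws :=
  alpha <= fair_frac (fill_hi y) (fun z => has (prefix (v ++ z)) ws).
(** A node of fillup level F consumes F + 1 bits, a number between fill_lo + 1 and fill_hi. Bits
    have positive costs, so testing these two extreme lengths controls all lengths in between. *)
Definition cheap (y : R) z :=
  self_info p (take (fill_lo y).+1 z) <= (fill_lo y).+1%:R * hm1.
Definition costly (y : R) z :=
  (fill_hi y)%:R * hm2 <= self_info p (take (fill_hi y) z).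

(** The last alternative is another string below v although at most e^(-y0) of them are expected;
    excluding it stops the branching. *)
Definition exceptional_at (y0 : R) (u : seq bool) (ws : seq (seq bool)) (m : nat) :=
  let v := take m u in let y := log_remaining (size ws) v in
  (y0 <= y) && [|| underfull y v ws, overfull y v ws,
                   cheap y (drop m u) | costly y (drop m u)]
  || (y <= - y0) && has (prefix v) ws.

(** Distinct words mean that M bits separate the strings, so that branching can be read off the
    words. *)
Definition exceptional (y0 : R) (M : nat) (us : seq (seq bool)) :=
  ~~ uniq us || has (exceptional_at y0 (head [::] us) (behead us)) (iota 0 M).

Lemma weaken_tail (y c c' K K' : R) : 0 <= y -> c' <= c -> 0 <= K <= K' ->
  K * expR (- (c * y)) <= K' * expR (- (c' * y)).
Proof.
move=> y0 cc /andP[K0 KK]; rewrite ler_pM ?expR_ge0// ler_expR lerN2.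
exact: ler_wpM2r.
Qed.

Lemma tails : exists c K, [/\ 0 < c, 0 <= K & forall y, 0 <= y -> [/\
   forall M N v, (0 < N)%N -> (size v + fill_lo y <= M)%N -> y = log_remaining N v ->
     iid (iid (coin p) M) N (fun ws => (underfull y v ws)%:R) <= K * expR (- (c * y)),
   forall M N v, y = log_remaining N v ->
     iid (iid (coin p) M) N (fun ws => (overfull y v ws)%:R) <= K * expR (- (c * y)),
   forall n, ((fill_lo y).+1 <= n)%N ->
     iid (coin p) n (fun z => (cheap y z)%:R) <= K * expR (- (c * y)) &
   forall n, (fill_hi y <= n)%N ->
     iid (coin p) n (fun z => (costly y z)%:R) <= K * expR (- (c * y))]].
Proof.
have [a0 a1] := andP alpha01.
have := rho2_gt; have := rho1_lt; set lam := coin 2^-1 (cost p) => r1 r2.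
have [c1 [K1 [c10 K10 H1]]] : exists c K, [/\ 0 < c, 0 <= K & forall M N k v, (0 < N)%N ->
    (size v + k <= M)%N -> k%:R <= rho1 * (ln N.+1%:R - self_info p v) ->
    iid (iid (coin p) M) N (fun ws => (iid (coin 2^-1) k
      (fun z => (1 < count (prefix (v ++ z)) ws)%N%:R) < alpha)%R%:R) <=
    K * expR (- (c * (ln N.+1%:R - self_info p v)))].
  (* mu is the midpoint of lam and 1 / rho1, hence rho1 mu < 1. The upper tail below uses the
     midpoint of lam and 1 / rho2. *)
  have lamE : lam < (lam + rho1^-1) / 2.
    by have : lam < rho1^-1 by [rewrite -[ltRHS]mul1r ltr_pdivlMr// mulrC]; lra.
  apply: (fillup_lower_tail p01 a1 rho1_gt0 lamE).
  by rewrite mulrA mulrDr divff ?gt_eqF//; lra.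
have [c2 [K2 [c20 K20 H2]]] : exists c K, [/\ 0 < c, 0 <= K & forall M N k v,
    rho2 * (ln N.+1%:R - self_info p v) <= k%:R ->
    iid (iid (coin p) M) N (fun ws => (alpha <= iid (coin 2^-1) k
      (fun z => (has (prefix (v ++ z)) ws)%:R))%R%:R) <=
    K * expR (- (c * (ln N.+1%:R - self_info p v)))].
  have lamE : rho2^-1 < lam by rewrite -[ltLHS]mul1r ltr_pdivrMr// mulrC.
  have i2 : 0 < rho2^-1 by rewrite invr_gt0.
  apply: (@fillup_upper_tail _ p alpha rho2 ((lam + rho2^-1) / 2) p01 a0).
  - by lra.
  - by rewrite -/lam; lra.
  - by rewrite mulrA mulrDr divff ?gt_eqF//; lra.
have [c3 c30 H3] : exists2 c, 0 < c & forall k, iid (coin p) k (fun s =>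
    (k%:R * - hm1 <= \sum_(b <- s) - cost p b)%R%:R) <= expR (- (c * k%:R)).
  by apply: (chernoff p01'); move: hm1_lt; rewrite /coin; lra.
have [c4 c40 H4] := chernoff p01' hm2_gt.
(* Chernoff's rates are per bit; the tested lengths are at least rho1 y and rho2 y, which turns them
   into rates in y. *)
pose c := Num.min (Num.min c1 c2) (Num.min (c3 * rho1) (c4 * rho2)).
exists c, (K1 + K2 + 1).
have cc1 : c <= c1 by rewrite !ge_min lexx.
have cc2 : c <= c2 by rewrite !ge_min lexx orbT.
have cc3 : c <= c3 * rho1 by rewrite !ge_min lexx !orbT.
have cc4 : c <= c4 * rho2 by rewrite !ge_min lexx !orbT.
split; [by rewrite !lt_min c10 c20 !mulr_gt0|by rewrite !addr_ge0|].
move=> y y0; split.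
- move=> M N v N0 vM yE; apply: (le_trans (H1 M N _ v N0 vM _)).
    by rewrite -/(log_remaining N v) -yE truncn_le// mulr_ge0// ltW.
  rewrite -/(log_remaining N v) -yE; apply: weaken_tail => //.
  by rewrite K10 -addrA lerDl addr_ge0.
- move=> M N v yE; apply: (le_trans (H2 M N _ v _)).
    by rewrite -/(log_remaining N v) -yE ltW// truncnS_gt.
  rewrite -/(log_remaining N v) -yE; apply: weaken_tail => //.
  by rewrite K20 addrAC lerDr addr_ge0.
- move=> n kn; rewrite (iid_take (coin_expectation p01') (fun z =>
    (self_info p z <= (fill_lo y).+1%:R * hm1)%R%:R) kn).
  apply: (@le_trans _ _ (1 * expR (- (c3 * rho1 * y)))); last first.
    by apply: weaken_tail => //; rewrite ler01 lerDr addr_ge0.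
  rewrite mul1r; apply: (@le_trans _ _ (expR (- (c3 * (fill_lo y).+1%:R)))).
    apply: le_trans (H3 _); rewrite le_eqVlt; apply/orP; left; apply/eqP.
    apply: (expectation_eq (iid_coin_expectation _ p01')) => z _.
    by rewrite mulrN sumrN lerN2.
  by rewrite ler_expR lerN2 -mulrA ler_pM2l// ltW// truncnS_gt.
- move=> n kn; rewrite (iid_take (coin_expectation p01') (fun z =>
    ((fill_hi y)%:R * hm2 <= self_info p z)%R%:R) kn).
  apply: (@le_trans _ _ (1 * expR (- (c4 * rho2 * y)))); last first.
    by apply: weaken_tail => //; rewrite ler01 lerDr addr_ge0.
  rewrite mul1r; apply: (le_trans (H4 _)).
  by rewrite ler_expR lerN2 -mulrA ler_pM2l// ltW// truncnS_gt.
Qed.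

End Exceptional.

Section ExceptionalSmall.
Context (R : realType) (p alpha : R).
Hypothesis p01 : 0 < p < 1.
Hypothesis alpha01 : 0 < alpha < 1.

Let p01' : 0 <= p <= 1. Proof. by case/andP: p01 => ? ?; rewrite !ltW. Qed.

Variables rho1 rho2 hm1 hm2 : R.
Hypothesis rho1_gt0 : 0 < rho1.
Hypothesis rho1_lt : rho1 * coin 2^-1 (cost p) < 1.
Hypothesis rho2_gt0 : 0 < rho2.
Hypothesis rho2_gt : 1 < rho2 * coin 2^-1 (cost p).
Hypothesis hm1_lt : hm1 < coin p (cost p).
Hypothesis hm2_gt : coin p (cost p) < hm2.

Definition min_cost : R := Num.min (cost p true) (cost p false).

Lemma min_cost_gt0 : 0 < min_cost.
Proof. by rewrite lt_min !cost_gt0. Qed.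

Lemma min_cost_le b : min_cost <= cost p b.
Proof. by rewrite /min_cost ge_min; case: b; rewrite lexx ?orbT. Qed.

Lemma log_remaining_step N u m : (m < size u)%N ->
  log_remaining p N (take m.+1 u) <= log_remaining p N (take m u) - min_cost.
Proof.
move=> mu; rewrite /log_remaining (take_nth false)// -cats1 self_info_cat opprD addrA.
by rewrite lerD2l lerN2 /self_info big_seq1 min_cost_le.
Qed.

Lemma log_remaining_le N u m : (m <= size u)%N ->
  log_remaining p N (take m u) <= ln N.+1%:R - min_cost * m%:R.
Proof.
move=> mu; rewrite lerD2l lerN2.
have := self_info_ge (take m u) min_cost_le.
by rewrite size_take_min (minn_idPl mu).
Qed.

Lemma expR_vanishes (C c delta : R) : 0 <= C -> 0 < c -> 0 < delta ->
  exists2 x0, 0 <= x0 & forall x, x0 <= x -> C * expR (- (c * x)) <= delta.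
Proof.
move=> C0 c0 d0; exists (C / (c * delta)); first by rewrite divr_ge0// mulr_ge0 ?(ltW c0) ?(ltW d0).
move=> x; rewrite ler_pdivrMr ?mulr_gt0// => Cx.
rewrite expRN ler_pdivrMr ?expR_gt0// (le_trans Cx)//.
have := expR_ge1Dx (c * x); rewrite -(ler_pM2l d0); lra.
Qed.

(** Given one word u, each other word equals it with probability at most e^(- self_info u) <= e^(-
    min_cost M). Adding words one at a time gives n + n^2 <= (n + 1)^2. *)
Lemma repetition_le M n :
  iid (iid (coin p) M) n (fun us => (~~ uniq us)%:R) <=
  n%:R ^+ 2 * expR (- (min_cost * M%:R)).
Proof.
have exw := iid_coin_expectation M p01'.
elim: n => [|n IH] /=; first by rewrite expr2 !mul0r.
have exn := iid_expectation exw n.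
apply: (@le_trans _ _ (iid (coin p) M (fun=>
    n%:R * expR (- (min_cost * M%:R)) + n%:R ^+ 2 * expR (- (min_cost * M%:R))))).
  apply: (expectation_le exw) => u /andP[/eqP uM _].
  apply: (@le_trans _ _ (iid (iid (coin p) M) n (fun us =>
      (has (prefix u) us)%:R + (~~ uniq us)%:R))).
    apply: (expectation_le exn) => us _.
    have [uus|_] := boolP (u \in us); last by rewrite /= lerDr.
    suff -> : has (prefix u) us by rewrite lerDl.
    by apply/hasP; exists u => //; exact: prefix_refl.
  rewrite (expectation_add exn) lerD// (le_trans (iid_has_le exw _ _))// ler_wpM2l//.
  apply: (le_trans (iid_coin_prefix_le _ _ p01)).
  by rewrite ler_expR lerN2 -[in leLHS]uM self_info_ge// => b; exact: min_cost_le.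
rewrite (expectation_cst exw) -mulrDl ler_wpM2r ?expR_ge0// -natr1.
have : 0 <= n%:R :> R by []; nra.
Qed.

(** Given v = take m u, the fill events depend only on the other words and the cost events only on
    the bits of u after v, so tail bounds for fixed v apply to all four. For y <= - y0 the mean
    number of other strings below v is at most e^y. *)
Lemma exceptional_at_le y0 c K N M m : 0 < y0 -> (0 < N)%N -> (m < M)%N ->
  (forall v y, size v = m -> y = log_remaining p N v -> y0 <= y -> [/\
     iid (iid (coin p) M) N (fun ws => (underfull alpha rho1 y v ws)%:R) <=
       K * expR (- (c * y)),
     iid (iid (coin p) M) N (fun ws => (overfull alpha rho2 y v ws)%:R) <=
       K * expR (- (c * y)),
     iid (coin p) (M - m) (fun z => (cheap p rho1 hm1 y z)%:R) <=
       K * expR (- (c * y)) &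
     iid (coin p) (M - m) (fun z => (costly p rho2 hm2 y z)%:R) <=
       K * expR (- (c * y))]) ->
  iid (coin p) M (fun u => iid (iid (coin p) M) N (fun ws =>
    (exceptional_at p alpha rho1 rho2 hm1 hm2 y0 u ws m)%:R)) <=
  iid (coin p) M (fun u => let y := log_remaining p N (take m u) in
    4 * K * ((y0 <= y)%R%:R * expR (- (c * y))) + (y <= - y0)%R%:R * expR y).
Proof.
move=> y00 N0 mM H.
have exw := iid_coin_expectation M p01'; have exN := iid_expectation exw N.
have exm := iid_coin_expectation m p01'.
have exMm := iid_coin_expectation (M - m) p01'.
pose Y u := log_remaining p N (take m u).
have size_m (u : seq bool) : size u = M -> size (take m u) = m by rewrite size_take => ->; rewrite mM.
have tail_part (Q : R -> pred (seq bool)) :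
    (forall v y, size v = m -> y = log_remaining p N v -> y0 <= y ->
      iid (coin p) (M - m) (fun z => (Q y z)%:R) <= K * expR (- (c * y))) ->
    iid (coin p) M (fun u => (y0 <= Y u)%R%:R * (Q (Y u) (drop m u))%:R) <=
    iid (coin p) M (fun u => (y0 <= Y u)%R%:R * (K * expR (- (c * Y u)))).
  move=> HQ; rewrite -[in leLHS](subnKC (ltnW mM)).
  pose F v z := let y := log_remaining p N v in (y0 <= y)%R%:R * (Q y z)%:R : R.
  rewrite (iid_take_drop (coin_expectation p01') m (M - m) F).
  rewrite (iid_take (coin_expectation p01') (fun v => let y := log_remaining p N v in
    (y0 <= y)%R%:R * (K * expR (- (c * y)))) (ltnW mM)).
  apply: (expectation_le exm) => v /andP[/eqP vm _].
  rewrite /F (expectation_scale exMm) /=.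
  have [h|h] := leP y0 (log_remaining p N v); last by rewrite !mul0r.
  by rewrite !mul1r; exact: (HQ v _ vm erefl h).
apply: (@le_trans _ _ (iid (coin p) M (fun u =>
    (y0 <= Y u)%R%:R * (cheap p rho1 hm1 (Y u) (drop m u))%:R +
    ((y0 <= Y u)%R%:R * (costly p rho2 hm2 (Y u) (drop m u))%:R +
    (2 * K * ((y0 <= Y u)%R%:R * expR (- (c * Y u))) + (Y u <= - y0)%R%:R * expR (Y u)))))).
  apply: (expectation_le exw) => u /andP[/eqP uM _].
  set C1 : R := (cheap _ _ _ _ _)%:R; set C2 : R := (costly _ _ _ _ _)%:R.
  have [y0Y|Yy0] := leP y0 (Y u).
    have [HA HB _ _] := H _ _ (size_m _ uM) erefl y0Y.
    have -> : (Y u <= - y0) = false by apply/negbTE; rewrite -ltNge; lra.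
    rewrite !mul1r mul0r addr0.
    apply: (@le_trans _ _ (iid (iid (coin p) M) N (fun ws =>
      (underfull alpha rho1 (Y u) (take m u) ws)%:R +
      ((overfull alpha rho2 (Y u) (take m u) ws)%:R + (C1 + C2))))).
      apply: (expectation_le exN) => ws /andP[/eqP wsN _].
      rewrite /exceptional_at wsN -/(Y u) y0Y /=.
      have -> : (Y u <= - y0) = false by apply/negbTE; rewrite -ltNge; lra.
      rewrite orbF /C1 /C2; move: (underfull _ _ _ _ _) (overfull _ _ _ _ _)
        (cheap _ _ _ _ _) (costly _ _ _ _ _) => [] [] [] [] /=; lra.
    rewrite !(expectation_add exN) !(expectation_cst exN).
    by rewrite -/(Y u) in HA HB; lra.
  rewrite !mul0r mulr0 !add0r.
  have [Yn|Yn] := leP (Y u) (- y0).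
    rewrite mul1r; apply: (@le_trans _ _ (iid (iid (coin p) M) N (fun ws =>
      (has (prefix (take m u)) ws)%:R))).
      apply: (expectation_le exN) => ws /andP[/eqP wsN _].
      by rewrite /exceptional_at wsN -/(Y u) (lt_geF Yy0) Yn.
    apply: (le_trans (iid_has_le exw _ _)).
    apply: (le_trans (ler_wpM2l _ (iid_coin_prefix_le _ _ p01))) => //.
    by rewrite /Y /log_remaining expRD lnK ?posrE// ler_pM2r ?expR_gt0// ler_nat.
  rewrite mul0r -[leRHS](expectation_zero exN); apply: (expectation_le exN) => ws.
  move=> /andP[/eqP wsN _].
  by rewrite /exceptional_at wsN -/(Y u) (lt_geF Yy0) (lt_geF Yn).
rewrite !(expectation_add exw).
have T1 := tail_part (cheap p rho1 hm1) (fun v y a b e => let: And4 _ _ h _ := H v y a b e in h).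
have T2 := tail_part (costly p rho2 hm2) (fun v y a b e => let: And4 _ _ _ h := H v y a b e in h).
have E K' : iid (coin p) M (fun u => K' * ((y0 <= Y u)%R%:R * expR (- (c * Y u)))) =
    K' * iid (coin p) M (fun u => (y0 <= Y u)%R%:R * expR (- (c * Y u))).
  by rewrite (expectation_scale exw).
have E' : iid (coin p) M (fun u => (y0 <= Y u)%R%:R * (K * expR (- (c * Y u)))) =
    K * iid (coin p) M (fun u => (y0 <= Y u)%R%:R * expR (- (c * Y u))).
  by rewrite -E; apply: (expectation_eq exw) => u _; rewrite mulrCA.
by move: T1 T2; rewrite E' !E; lra.
Qed.

(** The order of the quantifiers matters: [y0] is chosen before [N], and only the word length
    depends on [N]. The lower bound [Y0] leaves room for a later rounding error. *)
Lemma exceptional_small delta Y0 : 0 < delta ->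
  exists y0, [/\ Y0 <= y0, 0 < y0 & forall N, (0 < N)%N ->
    exists M0, forall M, (M0 <= M)%N ->
      iid (iid (coin p) M) N.+1 (fun us =>
        (exceptional p alpha rho1 rho2 hm1 hm2 y0 M us)%:R) <= delta].
Proof.
move=> d0; have g0 := min_cost_gt0.
have [c [K [c0 K0 H]]] :=
  tails p01 alpha01 rho1_gt0 rho1_lt rho2_gt0 rho2_gt hm1_lt hm2_gt.
have geo x : 0 < x -> 0 <= (1 - expR (- x))^-1.
  by move=> x0; rewrite invr_ge0 subr_ge0 -[leRHS]expR0 ler_expR oppr_le0 ltW.
have [x1 x10 H1] : exists2 x0, 0 <= x0 & forall x, x0 <= x ->
    4 * K * (1 - expR (- (c * min_cost)))^-1 * expR (- (c * x)) <= delta / 4.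
  by apply: expR_vanishes; rewrite ?divr_gt0// !mulr_ge0// geo// mulr_gt0.
have [x2 x20 H2] : exists2 x0, 0 <= x0 & forall x, x0 <= x ->
    (1 - expR (- min_cost))^-1 * expR (- (1 * x)) <= delta / 4.
  by apply: expR_vanishes; rewrite ?divr_gt0// geo.
pose y0 := Num.max Y0 (x1 + x2 + 1).
have y0x : x1 + x2 + 1 <= y0 by rewrite le_max lexx orbT.
have y00 : 0 < y0 by lra.
exists y0; split => //; first by rewrite le_max lexx.
move=> N N0; pose L : R := ln N.+1%:R.
have L0 : 0 <= L by rewrite ln_ge0// ler1n.
have [x3 x30 H3] : exists2 x0, 0 <= x0 & forall x, x0 <= x ->
    N.+1%:R ^+ 2 * expR (- (min_cost * x)) <= delta / 2.
  by apply: expR_vanishes; rewrite ?divr_gt0// exprn_ge0.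
(* The first summand makes repeated words rare. The others leave room for m bits followed by either
   tested length: y >= 0 forces m <= L / min_cost, and y <= L bounds both lengths. *)
exists ((Num.truncn x3).+1 + (Num.truncn (L / min_cost)) + (fill_lo rho1 L).+1 + fill_hi rho2 L)%N.
move=> M M0M; have exw := iid_coin_expectation M p01'.
have exN := iid_expectation exw N; have exN1 := iid_expectation exw N.+1.
apply: (@le_trans _ _ (iid (iid (coin p) M) N.+1 (fun us => (~~ uniq us)%:R +
    \sum_(m < M) (exceptional_at p alpha rho1 rho2 hm1 hm2 y0 (head [::] us) (behead us) m)%:R))).
  apply: (expectation_le exN1) => us _; rewrite /exceptional.
  set e := exceptional_at _ _ _ _ _ _ _ _ _.
  have [_|_] /= := boolP (uniq us); last by rewrite lerDl sumr_ge0.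
  rewrite add0r; have [/hasP[m]|_] /= := boolP (has e (iota 0 M)); last exact: sumr_ge0.
  rewrite mem_iota add0n => /andP[_ mM] em.
  by rewrite (bigD1 (Ordinal mM))//= em lerDl sumr_ge0.
rewrite (expectation_add exN1) (_ : delta = delta / 2 + (delta / 4 + delta / 4)); last by lra.
apply: lerD.
  have x3M : x3 <= M%:R; last exact: le_trans (repetition_le M N.+1) (H3 _ x3M).
  apply: (le_trans (ltW (truncnS_gt x3))).
  rewrite ler_nat.
  apply: leq_trans M0M.
  by rewrite -!addnA leq_addr.
rewrite (expectation_sum exN1) /=.
apply: (@le_trans _ _ (\sum_(m < M) iid (coin p) M (fun u =>
    let y := log_remaining p N (take m u) in
    4 * K * ((y0 <= y)%R%:R * expR (- (c * y))) + (y <= - y0)%R%:R * expR y))).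
  apply: ler_sum => m _; apply: exceptional_at_le => // v y vm yE y0y.
  have y_ge0 : 0 <= y by lra.
  have yL : y <= L - min_cost * m%:R.
    by rewrite yE -vm -[in leLHS](take_size v); apply: log_remaining_le.
  have mL : (m <= Num.truncn (L / min_cost))%N.
    by rewrite truncn_ge_nat ?divr_ge0 ?(ltW g0)// ler_pdivlMr// mulrC; lra.
  have yL' : y <= L by rewrite (le_trans yL)// gerBl mulr_ge0// ltW.
  have lo : (fill_lo rho1 y <= fill_lo rho1 L)%N by rewrite le_truncn// ler_pM2l.
  have hi : (fill_hi rho2 y <= fill_hi rho2 L)%N by rewrite ltnS le_truncn// ler_pM2l.
  have [bA bC bD] : [/\ size v + fill_lo rho1 y <= M, (fill_lo rho1 y).+1 <= M - m &
      fill_hi rho2 y <= M - m]%N.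
    move: M0M lo hi mL; rewrite vm.
    generalize (fill_lo rho1 y) (fill_lo rho1 L) (fill_hi rho2 y) (fill_hi rho2 L)
      (Num.truncn x3) (Num.truncn (L / min_cost)).
    clear; move: (nat_of_ord m) => k *; split; lia.
  have [HA HB HC HD] := H y y_ge0.
  by split; [exact: HA N0 bA yE|exact: HB yE|exact: HC bC|exact: HD bD].
rewrite -(expectation_sum exw) -[leRHS](expectation_cst exw).
apply: (expectation_le exw) => u /andP[/eqP uM _].
rewrite big_split /= -big_distrr /=.
have step m : (m.+1 < M)%N -> log_remaining p N (take m.+1 u) <=
    log_remaining p N (take m u) - min_cost.
  by move=> mM; rewrite log_remaining_step// uM ltnW.
apply: lerD.
  have := sum_expR_decreasing y0 g0 c0 step.
  move=> /(ler_wpM2l (mulr_ge0 (ler0n R 4) K0))/le_trans; apply.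
  by rewrite mulrA mulrAC H1//; lra.
apply: (le_trans (sum_expR_decreasing_neg y0 g0 step)).
by rewrite mulrC; have := H2 y0; rewrite (mul1r y0); apply; lra.
Qed.

End ExceptionalSmall.

(** * The law of the first bits of the strings *)

Section Law.
Context (R : realType) (p : R) (d : measure_display) (T : measurableType d).
Variables (P : probability T R) (xi : nat -> nat -> {RV P >-> bool}).
Hypothesis p01 : 0 < p < 1.
Hypothesis xi_law : forall i j : nat, P [set w | xi i j w = true] = p%:E.
Variables (n : nat) (J : {RV P >-> nat}).
Hypothesis J_law : forall k : nat, (k < n)%N -> P [set w | J w = k] = (n%:R^-1)%:E.
Hypothesis J_indep : mutually_independent P
  (fun o : option ('I_n * nat) =>
     if o is Some ij then sigma_of (xi ij.1 ij.2) else sigma_of J).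

Let p01' : 0 <= p <= 1. Proof. by case/andP: p01 => ? ?; rewrite !ltW. Qed.

Lemma measurable_bit i j b : measurable [set w | xi i j w = b].
Proof.
have := measurable_funPTI (xi i j : {mfun T >-> bool}) (Y := [set b]).
by apply.
Qed.

Lemma measurable_index k : measurable [set w | J w = k].
Proof.
have := measurable_funPTI (J : {mfun T >-> nat}) (Y := [set k]).
by apply.
Qed.

Lemma measurable_cylinder (K : seq ('I_n * nat)) (f : 'I_n * nat -> bool) k :
  measurable [set w | J w = k /\ forall x, x \in K -> xi x.1 x.2 w = f x].
Proof.
elim: K => [|x K IH].
  rewrite (_ : mkset _ = [set w | J w = k]); first exact: measurable_index.
  by apply/seteqP; split => w // -[].
rewrite (_ : mkset _ = [set w | xi x.1 x.2 w = f x] `&`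
    [set w | J w = k /\ forall x, x \in K -> xi x.1 x.2 w = f x]).
  by apply: measurableI => //; exact: measurable_bit.
apply/seteqP; split => w /=.
  move=> [Jw Kw]; split; first by rewrite Kw ?mem_head.
  by split => // y yK; rewrite Kw// inE yK orbT.
by move=> [xw [Jw Kw]]; split => // y; rewrite inE => /orP[/eqP ->|/Kw].
Qed.

Definition bit_prob (b : bool) : R := if b then p else 1 - p.

Lemma bit_law i j b : P [set w | xi i j w = b] = (bit_prob b)%:E.
Proof.
case: b; first exact: xi_law.
have -> : [set w | xi i j w = false] = ~` [set w | xi i j w = true].
  by apply/seteqP; split => w /=; case: (xi i j w).
by rewrite probability_setC ?xi_law//; exact: measurable_bit.
Qed.

Lemma cylinder_law (K : seq ('I_n * nat)) (f : 'I_n * nat -> bool) k :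
  uniq K -> (k < n)%N ->
  P [set w | J w = k /\ forall x, x \in K -> xi x.1 x.2 w = f x] =
  (n%:R^-1 * \prod_(x <- K) bit_prob (f x))%:E.
Proof.
move=> uK kn.
pose A := [fset o in None :: map some K]%fset.
pose E (o : option ('I_n * nat)) : set T :=
  if o is Some x then [set w | xi x.1 x.2 w = f x] else [set w | J w = k].
have AE o : (o \in A) = (o \in None :: map some K) by rewrite !inE.
have -> : [set w | J w = k /\ forall x, x \in K -> xi x.1 x.2 w = f x] =
    \bigcap_(o in [set` A]) E o.
  apply/seteqP; split => w /=.
    move=> [Jw xw] [x|] //=; rewrite AE inE /= => /mapP[y yK [->]]; exact: xw.
  move=> H; split; first by apply: (H None); rewrite /= AE inE.
  by move=> x xK; apply: (H (Some x)); rewrite /= AE inE /= map_f.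
rewrite (J_indep (E := E)); last first.
  move=> [x|] _ /=.
    by exists [set f x] => //; rewrite setTI.
  by exists [set k] => //; rewrite setTI.
rewrite (perm_big (None :: map some K)); last first.
  apply: uniq_perm; first exact: fset_uniq.
    rewrite /= map_inj_uniq ?uK ?andbT; [|by move=> ? ? []].
    by apply/mapP => -[].
  exact: AE.
rewrite big_cons big_map /= J_law// EFinM -prodEFin; congr (_ * _)%E.
by apply: eq_bigr => x _; exact: bit_law.
Qed.

(** The bits in [K] are already fixed; this generality drives the induction, which splits on the
    value of the head of [l] and moves it into [K]. Measurability is carried along for the
    additivity of [P]. *)
Lemma bits_law (l : seq ('I_n * nat)) k (K : seq ('I_n * nat)) (f : 'I_n * nat -> bool)
    (Q : pred (seq bool)) : uniq (l ++ K) -> (k < n)%N ->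
  let S := [set w | [/\ J w = k, forall x, x \in K -> xi x.1 x.2 w = f x &
                        Q [seq xi x.1 x.2 w | x : 'I_n * nat <- l]]] in
  measurable S /\ P S = (n%:R^-1 * \prod_(x <- K) bit_prob (f x) *
    iid (coin p) (size l) (fun s => (Q s)%:R))%:E.
Proof.
elim: l K f Q => [|x l IH] K f Q /= ulK kn.
  have [Q0|Q0] := boolP (Q [::]); last first.
    have -> : [set w | [/\ J w = k, forall x, x \in K -> xi x.1 x.2 w = f x & false]] = set0.
      by apply/seteqP; split => w // -[].
    by split; [exact: measurable0|rewrite measure0 mulr0].
  have -> : [set w | [/\ J w = k, forall x, x \in K -> xi x.1 x.2 w = f x & true]] =
      [set w | J w = k /\ forall x, x \in K -> xi x.1 x.2 w = f x].
    by apply/seteqP; split => w [].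
  by rewrite mulr1; split; [exact: measurable_cylinder|exact: cylinder_law].
pose g b y := if y == x then b else f y.
have xlK : x \notin l ++ K by case/andP: ulK.
have uxK : uniq (l ++ x :: K).
  by rewrite (@perm_uniq _ _ (x :: l ++ K))// -cat1s -[x :: l ++ K]cat1s perm_catCA.
have Kg b y : y \in K -> g b y = f y.
  move=> yK; rewrite /g; case: eqP => // yx.
  by rewrite -yx mem_cat yK orbT in xlK.
pose S b := [set w | [/\ J w = k, forall y, y \in x :: K -> xi y.1 y.2 w = g b y &
                        Q (b :: [seq xi y.1 y.2 w | y : 'I_n * nat <- l])]].
have -> : [set w | [/\ J w = k, forall y, y \in K -> xi y.1 y.2 w = f y &
    Q (xi x.1 x.2 w :: [seq xi y.1 y.2 w | y : 'I_n * nat <- l])]] = S true `|` S false.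
  apply/seteqP; split => w.
    move=> [Jw Kw Qw]; suff : S (xi x.1 x.2 w) w by case: (xi x.1 x.2 w); [left|right].
    split => // y; rewrite inE => /orP[/eqP ->|yK]; first by rewrite /g eqxx.
    by rewrite Kg// Kw.
  have sub b : S b w -> [/\ J w = k, forall y, y \in K -> xi y.1 y.2 w = f y &
      Q (xi x.1 x.2 w :: [seq xi y.1 y.2 w | y : 'I_n * nat <- l])].
    move=> [Jw Kw Qw]; split => //.
      by move=> y yK; rewrite -(Kg b)// Kw// inE yK orbT.
    by rewrite Kw ?mem_head// /g eqxx.
  by case; exact: sub.
have [mt Pt] := IH (x :: K) (g true) (fun s => Q (true :: s)) uxK kn.
have [mf Pf] := IH (x :: K) (g false) (fun s => Q (false :: s)) uxK kn.
split; first exact: measurableU.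
rewrite measureU//; last first.
  apply/seteqP; split => w // -[[_ /(_ x) + _] [_ /(_ x) + _]].
  by rewrite mem_head /g eqxx => -> // /(_ isT).
rewrite [X in (X + _)%E]Pt [X in (_ + X)%E]Pf -EFinD /= !big_cons.
have Pg b : \prod_(y <- K) bit_prob (g b y) = \prod_(y <- K) bit_prob (f y).
  by rewrite !big_seq; apply: eq_bigr => y yK; rewrite Kg.
have gx b : g b x = b by rewrite /g eqxx.
by congr EFin; rewrite !Pg !gx /coin /=; ring.
Qed.

Lemma iid_reshape A (E : (A -> R) -> R) D M m F : expectation D E ->
  iid (iid E M) m F = iid E (m * M) (fun s => F (reshape (nseq m M) s)).
Proof.
move=> exE; elim: m F => [//|m IH] F /=.
rewrite mulSn (iid_cat exE).
apply: (expectation_eq (iid_expectation exE M)) => s /andP[/eqP sM _].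
rewrite IH; apply: (expectation_eq (iid_expectation exE _)) => t _.
by rewrite -sM take_size_cat// drop_size_cat.
Qed.

(** The bridge from [P] to the finitary expectations: jointly with the event J = k, the first M bits
    of the listed strings form an independent sample. *)
Lemma words_law (js : seq 'I_n) M k (Q : pred (seq (seq bool))) :
  uniq js -> (k < n)%N ->
  let S := [set w | J w = k /\
     Q [seq [seq xi j t w | t <- iota 0 M] | j : 'I_n <- js]] in
  measurable S /\ P S = (n%:R^-1 *
    iid (iid (coin p) M) (size js) (fun us => (Q us)%:R))%:E.
Proof.
move=> ujs kn /=.
pose ll : seq (seq ('I_n * nat)) := [seq [seq (j, t) | t <- iota 0 M] | j <- js].
have ull : uniq (flatten ll ++ [::]) by rewrite cats0 allpairs_uniq ?iota_uniq// => -[? ?] [? ?].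
have sll : shape ll = nseq (size js) M.
  rewrite /ll; elim: js {ujs ull ll} => //= j js ->.
  by rewrite size_map size_iota.
have := @bits_law (flatten ll) k [::] (fun=> false)
  (fun s => Q (reshape (nseq (size js) M) s)) ull kn.
rewrite big_nil mulr1 size_flatten sll sumn_nseq mulnC.
rewrite -(iid_reshape M (size js) (fun us => (Q us)%:R) (coin_expectation p01')) /=.
set S1 := [set w | _]; set S2 := [set w | _]; suff -> : S1 = S2 by [].
have E w : reshape (nseq (size js) M) [seq xi x.1 x.2 w | x : 'I_n * nat <- flatten ll] =
    [seq [seq xi j t w | t <- iota 0 M] | j : 'I_n <- js].
  rewrite map_flatten -sll; set l2 := map (map _) ll.
  have -> : shape ll = shape l2.
    by rewrite /shape /l2 -map_comp; apply: eq_map => z /=; rewrite size_map.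
  by rewrite flattenK /l2 /ll -map_comp; apply: eq_map => j /=; rewrite -map_comp.
apply/seteqP; split => w; rewrite /S1 /S2 /= E; first by case.
by move=> [].
Qed.

End Law.

(** * Depths in level compressed tries *)

Section Trie.
Implicit Types (S : {fset bstring}) (s t : bstring) (v : seq bool).

(** That is, v is an internal node of the uncompressed trie. Plain sequences allow prefixes to be
    concatenated without the tuple lengths of [with_prefix]. *)
Definition branching S v : bool :=
  (1 < #|` [fset s in S | mkseq s (size v) == v]%fset|)%N.

Lemma fset_gt1P (K : choiceType) (A : {fset K}) :
  reflect (exists x y, [/\ x \in A, y \in A & x != y]) (1 < #|` A|)%N.
Proof.
apply: (iffP idP) => [A1|[x [y [xA yA xy]]]].
  have /fset0Pn[x xA] : A != fset0 by rewrite -cardfs_gt0 ltnW.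
  have /fset0Pn[y] : (A `\ x)%fset != fset0.
    by rewrite -cardfs_gt0; move: A1; rewrite (cardfsD1 x) xA.
  by rewrite !inE => /andP[yx yA]; exists x, y; rewrite xA yA eq_sym.
have : ([fset x; y] `<=` A)%fset by apply/fsubsetP => z; rewrite !inE => /orP[]/eqP ->.
by move/fsubset_leq_card; rewrite cardfs2 xy.
Qed.

Lemma branchingP S v : reflect
  (exists s t, [/\ s \in S, t \in S, s != t, mkseq s (size v) = v & mkseq t (size v) = v])
  (branching S v).
Proof.
apply: (iffP (fset_gt1P _)) => [[s [t]]|[s [t [sS tS st sv tv]]]].
  by rewrite !inE /= => -[/andP[sS /eqP sv] /andP[tS /eqP tv] st]; exists s, t.
by exists s, t; rewrite !inE /= sS tS sv tv eqxx.
Qed.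

Lemma branching_catl S v w : branching S (v ++ w) -> branching S v.
Proof.
move=> /branchingP[s [t [sS tS st sv tv]]]; apply/branchingP; exists s, t.
have pre (r : bstring) : mkseq r (size (v ++ w)) = v ++ w -> mkseq r (size v) = v.
  rewrite size_cat /mkseq iotaD map_cat => /eqP.
  by rewrite eqseq_cat ?size_map ?size_iota// => /andP[/eqP].
by split => //; exact: pre.
Qed.

Lemma val_bprefix m s : bprefix m s = mkseq s m :> seq bool.
Proof. by rewrite /= /mkseq -val_enum_ord -map_comp. Qed.

Lemma mkseq_bdrop m k s : mkseq s (m + k) = mkseq s m ++ mkseq (bdrop m s) k.
Proof.
by rewrite /mkseq iotaD map_cat add0n -[in iota m k](addn0 m) iotaDl -map_comp.
Qed.

Lemma bdrop_inj m s t : mkseq s m = mkseq t m -> bdrop m s = bdrop m t -> s = t.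
Proof.
move=> st dst; apply/funext => j; have [jm|mj] := ltnP j m.
  by rewrite -(nth_mkseq false s jm) st nth_mkseq.
by have := congr1 (fun f => f (j - m)%N) dst; rewrite /bdrop subnKC.
Qed.

Lemma bdrop_bdrop m k s : bdrop k (bdrop m s) = bdrop (m + k) s.
Proof. by apply/funext => j; rewrite /bdrop addnA. Qed.

Lemma in_below S m s z : reflect
  (exists t, [/\ t \in S, mkseq t m = mkseq s m & z = bdrop m t])
  (z \in below S (bprefix m s)).
Proof.
apply: (iffP (imfsetP _ _ _ _)) => /= [[t]|[t [tS ts zt]]].
  rewrite !inE /= => /andP[tS /eqP /(congr1 val)]; rewrite /= !val_bprefix => ts zt.
  by exists t.
exists t => //; rewrite !inE /= tS /=; apply/eqP/val_inj.
by rewrite /= !val_bprefix.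
Qed.

Lemma branching_below S m s v :
  branching (below S (bprefix m s)) v = branching S (mkseq s m ++ v).
Proof.
apply/branchingP/branchingP.
  move=> [_ [_ [/in_below[s1 [s1S s1s ->]] /in_below[t1 [t1S t1s ->]] st sv tv]]].
  exists s1, t1; split => //; first by apply: contraNneq st => ->.
    by rewrite size_cat size_mkseq mkseq_bdrop s1s sv.
  by rewrite size_cat size_mkseq mkseq_bdrop t1s tv.
move=> [s1 [t1 [s1S t1S st]]].
rewrite size_cat size_mkseq !mkseq_bdrop.
move=> /eqP; rewrite eqseq_cat ?size_mkseq// => /andP[/eqP s1s /eqP sv].
move=> /eqP; rewrite eqseq_cat ?size_mkseq// => /andP[/eqP t1s /eqP tv].
exists (bdrop m s1), (bdrop m t1); split => //.
- by apply/in_below; exists s1.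
- by apply/in_below; exists t1.
- by apply: contraNneq st => /(bdrop_inj _) ->//; rewrite s1s t1s.
Qed.

Lemma with_prefix_gt1 S k (r : k.-tuple bool) :
  (1 < #|` with_prefix S r|)%N = branching S r.
Proof.
rewrite /branching /with_prefix size_tuple.
by congr (1 < #|` _|)%N; apply/fsetP => s; rewrite !inE /= -val_eqE /= val_bprefix.
Qed.

Lemma below_gt1 S m s :
  (1 < #|` below S (bprefix m s)|)%N = branching S (mkseq s m).
Proof.
rewrite -[mkseq s m]cats0 -branching_below /branching.
by congr (1 < #|` _|)%N; apply/fsetP => z; rewrite !inE /= andbT.
Qed.

Lemma below_below S m k s :
  below (below S (bprefix m s)) (bprefix k (bdrop m s)) = below S (bprefix (m + k) s).
Proof.
apply/fsetP => z; apply/in_below/in_below.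
  move=> [_ [/in_below[t [tS ts ->]] dts ->]]; exists t; split => //.
    by rewrite !mkseq_bdrop ts dts.
  by rewrite bdrop_bdrop.
move=> [t [tS /eqP]]; rewrite !mkseq_bdrop eqseq_cat ?size_mkseq//.
move=> /andP[/eqP ts /eqP dts] ->; exists (bdrop m t); split => //.
  by apply/in_below; exists t.
by rewrite bdrop_bdrop.
Qed.

Lemma fair_fracE (R : realType) k (Q : pred (seq bool)) :
  fair_frac R k Q = 2 ^- k * #|[pred r : k.-tuple bool | Q r]|%:R.
Proof.
rewrite /fair_frac; elim: k Q => [|k IH] Q /=.
  rewrite expr0 invr1 mul1r; congr _%:R; rewrite -sum1_card.
  rewrite (eq_bigl (fun r : 0.-tuple bool => Q [::])); last first.
    by move=> r; rewrite tuple0.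
  by case: (Q [::]); rewrite ?big_pred0_eq// sum1_card card_tuple expn0.
pose c (x : bool * k.-tuple bool) := [tuple of x.1 :: x.2].
have cb : bijective c.
  exists (fun r : k.+1.-tuple bool => (thead r, [tuple of behead r])).
    by move=> [b r]; congr (_, _); apply/val_inj.
  by move=> r; rewrite [RHS]tuple_eta; apply/val_inj.
rewrite /coin !IH -[in RHS]sum1_card (reindex c) /=; last exact: onW_bij.
rewrite big_mkcond -(pair_bigA _ (fun b (r : k.-tuple bool) => if Q (b :: r) then 1 else 0)%N).
rewrite /= big_bool /= -!big_mkcond /= !sum1_card natrD exprS invfM.
suff E (a b : R) : 2^-1 * (2 ^- k * a) + (1 - 2^-1) * (2 ^- k * b) =
    2^-1 / 2 ^+ k * (a + b) by exact: E.
by field; rewrite expf_neq0.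
Qed.

Lemma level_ratio_below (R : realType) S m s k :
  level_ratio R (below S (bprefix m s)) k =
  fair_frac R k (fun z => branching S (mkseq s m ++ z)).
Proof.
rewrite fair_fracE /level_ratio /level_count; congr (_ * _%:R).
by apply: eq_card => r; rewrite !inE with_prefix_gt1 branching_below.
Qed.

Section Depth.
Context (R : realType) (alpha : R).
Hypothesis alpha_gt0 : 0 < alpha.
Hypothesis alpha_le1 : alpha <= 1.

(** The depth left after m bits of s, seen from the original set: [branching_below] and
    [below_below] turn the recursion on subtries into a recursion on m. *)
Definition depth_from S s m : nat :=
  lcdepth (lctrie_of alpha (below S (bprefix m s))) (bdrop m s).

Lemma depth_from0 S s : depth_from S s 0 = lcdepth (lctrie_of alpha S) s.
Proof.
rewrite /depth_from (_ : below _ _ = S)//; apply/fsetP => z; apply/in_below/idP.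
  by move=> [t [tS _ ->]].
by move=> zS; exists z.
Qed.

Lemma depth_from_leaf S s m : ~~ branching S (mkseq s m) -> depth_from S s m = 0%N.
Proof.
rewrite -below_gt1 /depth_from => b1.
have := lctrie_ofP alpha_gt0 alpha_le1 (below S (bprefix m s)).
case: lctrie_of => [|s'|k c] /is_lctrie_inv //.
by case=> b2; rewrite b2 in b1.
Qed.

Definition fillup_from S s m k : Prop :=
  alpha <= fair_frac R k (fun z => branching S (mkseq s m ++ z)) /\
  forall j, alpha <= fair_frac R j (fun z => branching S (mkseq s m ++ z)) -> (j <= k)%N.

Lemma depth_from_node S s m : branching S (mkseq s m) ->
  exists2 k, fillup_from S s m k &
    depth_from S s m = (depth_from S s (m + k.+1)).+1.
Proof.
rewrite -below_gt1 /depth_from => b2.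
have := lctrie_ofP alpha_gt0 alpha_le1 (below S (bprefix m s)).
case: lctrie_of => [|s'|k c] /is_lctrie_inv.
- by move=> E; rewrite E cardfs0 in b2.
- by move=> E; rewrite E cardfs1 in b2.
move=> [_ [Fk Fmax] cS]; exists k.
  by split => [|j]; rewrite -level_ratio_below//; exact: Fmax.
rewrite /= bdrop_bdrop; congr (lcdepth _ _).+1.
(* The child stored in the node and the trie picked by [lctrie_of] are tries of the same set. *)
apply: (is_lctrie_unique (cS _)); rewrite below_below.
exact: lctrie_ofP.
Qed.

End Depth.
End Trie.

Lemma uniq_map_inj (A B : eqType) (f : A -> B) (l : seq A) :
  uniq (map f l) -> {in l &, injective f}.
Proof.
move=> ul x y xl yl fxy.
rewrite -(nth_index x xl) -(nth_index x yl); congr nth; apply/eqP.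
by rewrite -(nth_uniq (f x) _ _ ul) ?size_map ?index_mem// !(nth_map x) ?index_mem// !nth_index// fxy.
Qed.

(** * Depth of the followed string in a non-exceptional sample *)

Section Sample.
Context (R : realType) (p alpha : R).
Hypothesis p01 : 0 < p < 1.
Hypothesis alpha_gt0 : 0 < alpha.
Variables (s0 : bstring) (ss : seq bstring) (S : {fset bstring}) (M : nat).
Hypothesis SE : forall z, (z \in S) = (z \in s0 :: ss).
Let words := [seq mkseq z M | z <- ss].
Hypothesis words_uniq : uniq (mkseq s0 M :: words).

Let fair01 : 0 <= (2^-1 : R) <= 1. Proof. by apply/andP; split; lra. Qed.

Lemma take_mkseq (z : bstring) m n : (m <= n)%N -> take m (mkseq z n) = mkseq z m.
Proof. by move=> mn; rewrite -(subnKC mn) mkseq_bdrop take_size_cat ?size_mkseq. Qed.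

Lemma drop_mkseq (z : bstring) m n : (m <= n)%N ->
  drop m (mkseq z n) = mkseq (bdrop m z) (n - m).
Proof. by move=> mn; rewrite -{1}(subnKC mn) mkseq_bdrop drop_size_cat ?size_mkseq. Qed.

Lemma prefix_mkseq w (z : bstring) : (size w <= M)%N ->
  prefix w (mkseq z M) = (mkseq z (size w) == w).
Proof. by move=> wM; rewrite prefixE take_mkseq. Qed.

Lemma word_inj : {in S &, injective (fun z : bstring => mkseq z M)}.
Proof.
move=> x y; rewrite !SE => xs ys.
exact: (uniq_map_inj (words_uniq : uniq [seq mkseq z M | z <- s0 :: ss])).
Qed.

Lemma branching_size w : branching S w -> (size w < M)%N.
Proof.
move=> /branchingP[x [y [xS yS xy xw yw]]]; rewrite ltnNge; apply/negP => Mw.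
case/eqP: xy; apply: word_inj => //.
by rewrite -(take_mkseq x Mw) -(take_mkseq y Mw) xw yw.
Qed.

(** Of two distinct strings one differs from s0, so branching puts another word below w; conversely,
    by [count_branching], two other words below w force branching. Through this sandwich [underfull]
    and [overfull] control the fillup level. *)
Lemma branching_has w : branching S w -> has (prefix w) words.
Proof.
move=> b; have wM := ltnW (branching_size b); move/branchingP: b.
move=> [x [y [xS yS xy xw yw]]]; move: xS yS; rewrite !SE !inE.
have mem z : z \in ss -> mkseq z (size w) = w -> has (prefix w) words.
  move=> zs zw; apply/hasP; exists (mkseq z M); first exact: map_f.
  by rewrite prefix_mkseq// zw.
move=> /orP[/eqP xs0|xs _]; last exact: mem xw.
move=> /orP[/eqP ys0|ys]; last exact: mem yw.
by rewrite xs0 ys0 eqxx in xy.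
Qed.

Lemma count_branching w : (1 < count (prefix w) words)%N -> branching S w.
Proof.
rewrite -size_filter.
have : uniq [seq x <- words | prefix w x] by rewrite filter_uniq//; case/andP: words_uniq.
case E : [seq x <- words | prefix w x] => [|x [|y l]]//= /andP[xy _] _.
have mem z : z \in [:: x, y & l] -> exists t, [/\ t \in S, z = mkseq t M & mkseq t (size w) = w].
  rewrite -E mem_filter => /andP[wz /mapP[t ts zt]]; exists t; rewrite SE inE ts orbT zt.
  split => //; apply/eqP; rewrite -prefix_mkseq -?zt//.
  by rewrite -(size_mkseq t M) -zt; move/prefixP: wz => [x' ->]; rewrite size_cat leq_addr.
have [t [tS xt tw]] := mem x (mem_head _ _).
have [t' [t'S yt t'w]] : exists t, [/\ t \in S, y = mkseq t M & mkseq t (size w) = w].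
  by apply: mem; rewrite !inE eqxx orbT.
apply/branchingP; exists t, t'; split => //.
by apply: contraNneq xy => tt'; rewrite xt yt tt' mem_head.
Qed.

Lemma fair_frac_le k (Q Q' : pred (seq bool)) :
  (forall z, size z = k -> Q z -> Q' z) -> fair_frac R k Q <= fair_frac R k Q'.
Proof.
move=> QQ; apply: (expectation_le (iid_coin_expectation k fair01)) => z /andP[/eqP zk _].
by have [/(QQ _ zk) ->|_] := boolP (Q z).
Qed.

Lemma fair_frac_gt0 k (Q : pred (seq bool)) : 0 < fair_frac R k Q ->
  exists2 z, size z = k & Q z.
Proof.
move=> Q0; apply: contrapT => nQ.
suff : fair_frac R k Q <= 0 by rewrite leNgt Q0.
rewrite -(expectation_zero (iid_coin_expectation k fair01)).
apply: (expectation_le (iid_coin_expectation k fair01)) => z /andP[/eqP zk _].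
by have [Qz|//] := boolP (Q z); case: nQ; exists z.
Qed.

(** Prefix-closed properties, such as branching, become rarer with length. Hence a level that fails
    the alpha test bounds the fillup level. *)
Lemma fair_frac_take j k (Q : pred (seq bool)) :
  (forall v w, Q (v ++ w) -> Q v) -> (j <= k)%N -> fair_frac R k Q <= fair_frac R j Q.
Proof.
move=> Qcat jk; rewrite /fair_frac -(iid_take (coin_expectation fair01) _ jk).
apply: (expectation_le (iid_coin_expectation k fair01)) => z _.
have [|_] := boolP (Q z); last by [].
by rewrite -{1}(cat_take_drop j z) => /Qcat ->.
Qed.

Variables (rho1 rho2 hm1 hm2 y0 k1 k2 : R).
Let N := size ss.
Let y m := log_remaining p N (mkseq s0 m).
Hypothesis y0_gt0 : 0 < y0.
Hypothesis rho2_gt0 : 0 < rho2.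
Hypothesis hm1_gt0 : 0 < hm1.
Hypothesis hm2_gt0 : 0 < hm2.
Hypothesis k2E : 1 - rho1 * hm1 <= k2.
Hypothesis k1E : k1 <= 1 - rho2 * hm2 - hm2 / y0.
Hypothesis M_large : ln N.+1%:R <= min_cost p * M%:R.
Hypothesis ordinary :
  ~~ exceptional p alpha rho1 rho2 hm1 hm2 y0 M (mkseq s0 M :: words).

Lemma not_exceptional_at m : (m < M)%N ->
  ~~ exceptional_at p alpha rho1 rho2 hm1 hm2 y0 (mkseq s0 M) words m.
Proof.
move=> mM; apply: contraNN ordinary => e; apply/orP; right.
by apply/hasP; exists m; rewrite ?mem_iota.
Qed.

Lemma y_le m : y m <= ln N.+1%:R - min_cost p * m%:R.
Proof.
rewrite /y -[mkseq s0 m]take_size; apply: le_trans (log_remaining_le _ _ _) _ => //.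
by rewrite size_mkseq.
Qed.

Lemma y_add m k : y (m + k) = y m - self_info p (mkseq (bdrop m s0) k).
Proof. by rewrite /y /log_remaining mkseq_bdrop self_info_cat; ring. Qed.

Lemma y_decreasing m k : y (m + k.+1) <= y m - min_cost p.
Proof.
rewrite y_add lerD2l lerN2.
apply: le_trans (self_info_ge _ (min_cost_le p)); rewrite size_mkseq.
by rewrite ler_peMr ?ler1n// ltW// min_cost_gt0.
Qed.

(** The fillup level k satisfies fill_lo <= k < fill_hi, so the k + 1 bits consumed cost between
    rho1 hm1 y and (rho2 y + 1) hm2. *)
Lemma ordinary_large m : y0 <= y m -> branching S (mkseq s0 m) /\
  forall k, fillup_from alpha S s0 m k -> k1 * y m <= y (m + k.+1) <= k2 * y m.
Proof.
move=> y0m; have y_gt0 := lt_le_trans y0_gt0 y0m.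
(* From level M on, [M_large] would make y nonpositive. *)
have mM : (m < M)%N.
  rewrite ltnNge; apply/negP => Mm.
  have : min_cost p * M%:R <= min_cost p * m%:R by rewrite ler_pM2l ?min_cost_gt0// ler_nat.
  have := M_large; have := y_le m; lra.
have := not_exceptional_at mM; rewrite /exceptional_at take_mkseq ?(ltnW mM)//.
rewrite size_map drop_mkseq ?(ltnW mM)// -/N -/(y m) y0m /= negb_or => /andP[+ _].
rewrite !negb_or => /and4P[under over ncheap ncostly].
have lo_fill : alpha <= fair_frac R (fill_lo rho1 (y m))
    (fun z => branching S (mkseq s0 m ++ z)).
  by rewrite /underfull -leNgt in under; apply: (le_trans under); apply: fair_frac_le => z _ /count_branching.
split.
  have [z _ bz] := fair_frac_gt0 (lt_le_trans alpha_gt0 lo_fill).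
  exact: branching_catl bz.
move=> k [k_fill k_max]; have lo_k := k_max _ lo_fill.
have k_hi : (k < fill_hi rho2 (y m))%N.
  rewrite ltnNge; apply/negP => hi_k.
  suff : alpha < alpha by rewrite ltxx.
  apply: (le_lt_trans k_fill).
  apply: (@le_lt_trans _ _ (fair_frac R (fill_hi rho2 (y m))
      (fun z => branching S (mkseq s0 m ++ z)))).
    apply: fair_frac_take hi_k => v w; rewrite catA; exact: branching_catl.
  rewrite /overfull -ltNge in over; apply: le_lt_trans over.
  by apply: fair_frac_le => z _; exact: branching_has.
(* A filled level holds a branching word, of length m + k < M, so the M-bit word contains all k + 1
   bits. *)
have kM : (k.+1 <= M - m)%N.
  have [z zk /branching_size] := fair_frac_gt0 (lt_le_trans alpha_gt0 k_fill).
  rewrite size_cat size_mkseq zk; clear; lia.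
rewrite y_add.
rewrite /cheap -ltNge in ncheap; rewrite /costly -ltNge in ncostly.
set x := self_info p _.
have x_lo : (fill_lo rho1 (y m)).+1%:R * hm1 <= x.
  apply: (le_trans (ltW ncheap)); rewrite /x -(take_mkseq _ kM).
  exact: self_info_take_le.
have x_hi : x <= (fill_hi rho2 (y m))%:R * hm2.
  apply: le_trans (ltW ncostly); rewrite /x -(take_mkseq _ kM).
  exact: self_info_take_le.
have lo1 : rho1 * y m <= (fill_lo rho1 (y m)).+1%:R by rewrite ltW// truncnS_gt.
have hi1 : (fill_hi rho2 (y m))%:R <= rho2 * y m + 1.
  by rewrite /fill_hi -natr1 lerD2r truncn_le mulr_ge0// ltW.
apply/andP; split.
  (* The rounding in [fill_hi] costs at most hm2 <= (hm2 / y0) y, as y >= y0; this is the last term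
     of [k1E]. *)
  have : hm2 <= hm2 / y0 * y m by rewrite -mulrA ler_peMr ?(ltW hm2_gt0)// mulrC ler_pdivlMr// mul1r.
  have : k1 * y m <= (1 - rho2 * hm2 - hm2 / y0) * y m by rewrite ler_pM2r.
  have := ler_wpM2r (ltW hm2_gt0) hi1; lra.
have : (1 - rho1 * hm1) * y m <= k2 * y m by rewrite ler_pM2r.
have := ler_wpM2r (ltW hm1_gt0) lo1; lra.
Qed.

Lemma ordinary_small m : y m <= - y0 -> ~~ branching S (mkseq s0 m).
Proof.
move=> ym; have [mM|Mm] := ltnP m M; last first.
  by apply/negP => /branching_size; rewrite size_mkseq ltnNge Mm.
have := not_exceptional_at mM; rewrite /exceptional_at take_mkseq ?(ltnW mM)//.
rewrite size_map -/N -/(y m) ym negb_or => /andP[_]; apply: contra.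
exact: branching_has.
Qed.

Hypothesis alpha_le1 : alpha <= 1.
Hypothesis k1_gt0 : 0 < k1.
Hypothesis k2_gt0 : 0 < k2.

(** After j nodes y is still at least y0, which forces one more node; hence the strict
    inequality. *)
Lemma ordinary_depth_ge j m : y0 <= k1 ^+ j * y m -> (j < depth_from alpha S s0 m)%N.
Proof.
have k1_le1 : k1 <= 1.
  by have := divr_ge0 (ltW hm2_gt0) (ltW y0_gt0); have := mulr_gt0 rho2_gt0 hm2_gt0; have := k1E; lra.
elim: j m => [|j IH] m y0m.
  rewrite expr0 mul1r in y0m; have [b _] := ordinary_large y0m.
  by have [k _ ->] := depth_from_node alpha_gt0 alpha_le1 b.
have y0m' : y0 <= y m.
  apply: (le_trans y0m); rewrite ler_piMl// ?exprn_ile1// ?ltW//.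
  by rewrite -(pmulr_rgt0 _ (exprn_gt0 j.+1 k1_gt0)) (lt_le_trans y0_gt0).
have [b H] := ordinary_large y0m'.
have [k Fk ->] := depth_from_node alpha_gt0 alpha_le1 b.
rewrite ltnS; apply: IH; apply: (le_trans y0m).
by rewrite exprSr -mulrA ler_pM2l ?exprn_gt0//; case/andP: (H k Fk).
Qed.

(** In the window |y| < y0 no fillup level is controlled, but every node consumes at least one bit.
    So y falls by [min_cost] per node until it reaches - y0, where branching stops. *)
Lemma ordinary_depth_le_small r m : y m <= - y0 + r%:R * min_cost p ->
  (depth_from alpha S s0 m <= r)%N.
Proof.
elim: r m => [|r IH] m ym.
  by rewrite depth_from_leaf// ordinary_small//; lra.
have [b|/depth_from_leaf ->//] := boolP (branching S (mkseq s0 m)).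
have [k _ ->] := depth_from_node alpha_gt0 alpha_le1 b.
rewrite ltnS IH//; have := y_decreasing m k.
by move: ym; rewrite -natr1; lra.
Qed.

(** At most j nodes bring y below y0, and r further nodes cover the window of width 2 y0. *)
Lemma ordinary_depth_le j r m : 2 * y0 <= r%:R * min_cost p -> k2 ^+ j * y m < y0 ->
  (depth_from alpha S s0 m <= j + r)%N.
Proof.
move=> hr; elim: j m => [|j IH] m ym.
  by apply: ordinary_depth_le_small; rewrite expr0 mul1r in ym; lra.
have [y0m|ym0] := leP y0 (y m); last first.
  apply: (@leq_trans r); last exact: leq_addl.
  by apply: ordinary_depth_le_small; lra.
have [b H] := ordinary_large y0m.
have [k Fk ->] := depth_from_node alpha_gt0 alpha_le1 b.
rewrite ltnS; apply: IH; apply: le_lt_trans ym.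
by rewrite exprSr -mulrA ler_pM2l ?exprn_gt0//; case/andP: (H k Fk).
Qed.

End Sample.

(** * Measurability of the depth *)

Lemma in_first_strings (T : Type) (b : nat -> nat -> T -> bool) n w z : reflect
  (exists2 i, (i < n)%N & z = string_at b w i) (z \in first_strings b n w).
Proof.
apply: (iffP (imfsetP _ _ _ _)) => -[i /= ilt ->]; exists i => //.
  by rewrite mem_iota in ilt.
by rewrite /= mem_iota.
Qed.

Section Measurability.
Context (d : measure_display) (T : measurableType d).
Implicit Types (A B : T -> Prop).

Lemma measurable_and A B : measurable [set w | A w] -> measurable [set w | B w] ->
  measurable [set w | A w /\ B w].
Proof. exact: measurableI. Qed.

Lemma measurable_not A : measurable [set w | A w] -> measurable [set w | ~ A w].
Proof. exact: measurableC. Qed.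

Lemma measurable_ex (U : countType) (A : U -> T -> Prop) :
  (forall x, measurable [set w | A x w]) -> measurable [set w | exists x, A x w].
Proof.
move=> mA; rewrite (_ : mkset _ = \bigcup_(x in [set: U]) [set w | A x w]).
  by apply: countable_bigcupT_measurable => //; exact: countableP.
by apply/seteqP; split => w /= [x]; [exists x|move=> _; exists x].
Qed.

Lemma measurable_iff A B : (forall w, A w <-> B w) ->
  measurable [set w | A w] -> measurable [set w | B w].
Proof.
move=> AB; rewrite (_ : [set w | A w] = [set w | B w])//.
by apply/seteqP; split => w /AB.
Qed.

Lemma measurable_cst (A : Prop) : measurable [set _ : T | A].
Proof.
have [a|na] := pselect A; first by rewrite (_ : mkset _ = setT)//; apply/seteqP; split.
by rewrite (_ : mkset _ = set0)//; apply/seteqP; split.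
Qed.

Lemma measurable_all (U : countType) (A : U -> T -> Prop) :
  (forall x, measurable [set w | A x w]) -> measurable [set w | forall x, A x w].
Proof.
move=> mA; apply: (@measurable_iff (fun w => ~ exists x, ~ A x w)).
  by move=> w; split => [nA x|Aw [x]]; [apply: contrapT => nAx; apply: nA; exists x|apply].
by apply/measurable_not/measurable_ex => x; exact: measurable_not.
Qed.

Context (R : realType) (alpha : R).
Hypothesis alpha_gt0 : 0 < alpha.
Hypothesis alpha_le1 : alpha <= 1.
Variables (b : nat -> nat -> T -> bool) (n : nat).
Hypothesis mb : forall i j c, measurable [set w | b i j w = c].

Let S := first_strings b n.
Let s i w := string_at b w i.

Lemma measurable_word i m v : measurable [set w | mkseq (s i w) m = v].
Proof.
apply: (@measurable_iff (fun w => size v = m /\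
    forall j : 'I_m, b i j w = nth false v j)).
  move=> w; split => [[vm H]|<-].
    apply: (@eq_from_nth _ false); rewrite ?size_mkseq// => j jm.
    by rewrite nth_mkseq// -(H (Ordinal jm)).
  by split => [|j]; rewrite ?size_mkseq ?nth_mkseq.
apply: measurable_and; first exact: measurable_cst.
by apply: measurable_all => j; exact: mb.
Qed.

Lemma measurable_branching v : measurable [set w | branching (S w) v].
Proof.
(* Distinctness of two strings is witnessed by one bit position t, which keeps the quantifiers
   countable. *)
apply: (@measurable_iff (fun w => exists i j : 'I_n, exists t c,
   (b i t w = c /\ b j t w = ~~ c) /\
   (mkseq (s i w) (size v) = v /\ mkseq (s j w) (size v) = v))).
  move=> w; split => [[i [j [t [c [[bi bj] [iv jv]]]]]]|/branchingP].
    apply/branchingP; exists (s i w), (s j w); split => //; last first.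
    - by apply/eqP => /(congr1 (fun f => f t)); rewrite /s /string_at bi bj; case: (c).
    - by apply/in_first_strings; exists j.
    - by apply/in_first_strings; exists i.
  move=> [_ [_ [/in_first_strings[i ilt ->] /in_first_strings[j jlt ->] ij iv jv]]].
  exists (Ordinal ilt), (Ordinal jlt) => /=.
  have [t ijt] : exists t, b i t w != b j t w.
    apply: contrapT => H; case/eqP: ij; apply/funext => t.
    by apply: contrapT => /eqP Ht; apply: H; exists t.
  exists t, (b i t w); split => //; split => //.
  by move: ijt; case: (b i t w); case: (b j t w).
apply: measurable_ex => i; apply: measurable_ex => j.
apply: measurable_ex => t; apply: measurable_ex => c.
apply: measurable_and; apply: measurable_and; try exact: mb; exact: measurable_word.
Qed.

Lemma measurable_branching_from i m z :
  measurable [set w | branching (S w) (mkseq (s i w) m ++ z)].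
Proof.
apply: (@measurable_iff (fun w => exists v : seq bool,
    mkseq (s i w) m = v /\ branching (S w) (v ++ z))).
  by move=> w; split => [[v [<-]]|bw]; last exists (mkseq (s i w) m).
apply: measurable_ex => v; apply: measurable_and.
  exact: measurable_word.
exact: measurable_branching.
Qed.

Lemma measurable_fill i m k : measurable [set w | alpha <=
  fair_frac R k (fun z => branching (S w) (mkseq (s i w) m ++ z))].
Proof.
(* Quantifying over the finite table Q of branching words makes the comparison with alpha
   independent of w. *)
apply: (@measurable_iff (fun w => exists Q : {ffun k.-tuple bool -> bool},
    (forall r : k.-tuple bool, branching (S w) (mkseq (s i w) m ++ r) = Q r) /\
    alpha <= 2 ^- k * #|[pred r | Q r]|%:R)).
  move=> w; rewrite fair_fracE; split => [[Q [EQ aQ]]|aQ].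
    rewrite (_ : #|_| = #|[pred r | Q r]|)//.
    by apply: eq_card => r; rewrite !inE EQ.
  exists [ffun r : k.-tuple bool => branching (S w) (mkseq (s i w) m ++ r)]; split.
    by move=> r; rewrite ffunE.
  rewrite (_ : #|_| = #|[pred r : k.-tuple bool | branching (S w) (mkseq (s i w) m ++ r)]|)//.
  by apply: eq_card => r; rewrite !inE ffunE.
apply: measurable_ex => Q; apply: measurable_and; last exact: measurable_cst.
apply: measurable_all => r; case: (Q r).
  exact: measurable_branching_from.
apply: (@measurable_iff (fun w => ~ branching (S w) (mkseq (s i w) m ++ r))).
  by move=> w; case: branching; split => // /(_ isT).
exact/measurable_not/measurable_branching_from.
Qed.

Lemma measurable_fillup i m k : measurable [set w | fillup_from alpha (S w) (s i w) m k].
Proof.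
apply: measurable_and; first exact: measurable_fill.
apply: measurable_all => j.
have [jk|kj] := leqP j k.
  by apply: (@measurable_iff (fun=> True)); [move=> w; split|exact: measurable_cst].
apply: (@measurable_iff (fun w => ~ alpha <=
    fair_frac R j (fun z => branching (S w) (mkseq (s i w) m ++ z)))).
  by move=> w; split => // H /H.
exact/measurable_not/measurable_fill.
Qed.

(** The trie is picked by a choice operator, which says nothing about measurability. Unfolding one
    node at a time expresses the event by countably many conditions on branching and fillup
    levels. *)
Lemma measurable_depth_from i m j :
  measurable [set w | (j <= depth_from alpha (S w) (s i w) m)%N].
Proof.
elim: j m => [|j IH] m.
  by apply: (@measurable_iff (fun=> True)); [move=> w; split|exact: measurable_cst].
apply: (@measurable_iff (fun w => branching (S w) (mkseq (s i w) m ++ [::]) /\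
  exists k, fillup_from alpha (S w) (s i w) m k /\
    (j <= depth_from alpha (S w) (s i w) (m + k.+1))%N)).
  move=> w; rewrite cats0; split => [[bw [k [[Fk Fmax] jk]]]|jw].
    have [k' [Fk' Fmax'] ->] := depth_from_node alpha_gt0 alpha_le1 bw.
    suff -> : k' = k by [].
    by apply/eqP; rewrite eqn_leq Fmax ?Fmax'.
  have [bw|/(depth_from_leaf alpha_gt0 alpha_le1) d0] :=
    boolP (branching (S w) (mkseq (s i w) m)); last by rewrite d0 in jw.
  split => //; have [k Fk dk] := depth_from_node alpha_gt0 alpha_le1 bw.
  by exists k; split => //; rewrite dk in jw.
apply: measurable_and; first exact: measurable_branching_from.
apply: measurable_ex => k; apply: measurable_and; last exact: IH.
exact: measurable_fillup.
Qed.

Variable J : T -> nat.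
Hypothesis mJ : forall k, measurable [set w | J w = k].

Lemma measurable_random_depth (Q : nat -> Prop) :
  measurable [set w | Q (random_depth alpha b J n w)].
Proof.
apply: (@measurable_iff (fun w => exists i j, J w = i /\
  ((j <= depth_from alpha (S w) (s i w) 0)%N /\
   ~ (j.+1 <= depth_from alpha (S w) (s i w) 0)%N) /\ Q j)).
  move=> w; have E : random_depth alpha b J n w = depth_from alpha (S w) (s (J w) w) 0.
    by rewrite depth_from0.
  rewrite E; split => [[i [j [-> [[jd /negP dj] Qj]]]]|Qd].
    by rewrite -leqNgt in dj; have /eqP <- : j == depth_from alpha (S w) (s i w) 0
      by rewrite eqn_leq jd dj.
  exists (J w), (depth_from alpha (S w) (s (J w) w) 0%N).
  by split => //; split => //; split => //; rewrite ltnn.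
apply: measurable_ex => i; apply: measurable_ex => j.
apply: measurable_and; first exact: mJ.
apply: measurable_and; last exact: measurable_cst.
apply: measurable_and; first exact: measurable_depth_from.
exact/measurable_not/measurable_depth_from.
Qed.

End Measurability.

(** * Convergence *)

Section Asymptotics.
Variable R : realType.

(** At the ideal values rho = 1 / lam and hm = h the contraction 1 - rho hm is 1 - h / lam.
    Perturbing both by a factor 1 - e or 1 + e changes it by O(e). *)
Lemma rates (h lam k1 k2 : R) : 0 < h -> h < lam -> k1 < 1 - h / lam < k2 ->
  exists rho1 rho2 hm1 hm2, [/\ 0 < rho1, rho1 * lam < 1, 0 < rho2 & 1 < rho2 * lam] /\
    [/\ 0 < hm1, hm1 < h, h < hm2, 1 - rho1 * hm1 <= k2 & k1 < 1 - rho2 * hm2].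
Proof.
move=> h0 hlam /andP[k1k kk2]; have lam0 : 0 < lam := lt_trans h0 hlam.
set t := h / lam in k1k kk2.
have t0 : 0 < t by rewrite divr_gt0.
have t1 : t < 1 by rewrite ltr_pdivrMr// mul1r.
have [e [e0 e2 ek1 ek2]] : exists e, [/\ 0 < e, e <= 2^-1, 4 * e <= 1 - t - k1 & 2 * e <= k2 - (1 - t)].
  exists (Num.min 2^-1 (Num.min ((1 - t - k1) / 4) ((k2 - (1 - t)) / 2))); split.
  - by rewrite !lt_min; apply/and3P; split; lra.
  - by rewrite ge_min lexx.
  - rewrite mulrC -ler_pdivlMr//; by rewrite !ge_min lexx !orbT.
  - rewrite mulrC -ler_pdivlMr//; by rewrite !ge_min lexx !orbT.
exists ((1 - e) / lam), ((1 + e) / lam), ((1 - e) * h), ((1 + e) * h).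
have rh (x y : R) : x / lam * (y * h) = x * y * t by rewrite /t; ring.
rewrite !rh !mulfVK ?gt_eqF//.
have e1 : 0 < 1 - e by lra.
have e1' : 0 < 1 + e by lra.
by split; split; rewrite ?divr_gt0 ?mulr_gt0//; nra.
Qed.

(** Meant for l = ln (ln n), A = ln y0, c = ln (ln 2) and B the bounded number of extra nodes: for
    large l these constants are small against eps l, and eta accounts for the rest. *)
Lemma depth_ratio (th eta eps A B c l D : R) : 0 < th -> 0 < eps ->
  0 < eta -> eta <= 2^-1 -> 4 * eta <= eps -> 0 <= B ->
  (2 * `|A| + th * B + (1 + eps) * `|c|) * 2 < eps * l -> `|A| + `|c| < l ->
  (l - A) / (th * (1 + eta)) <= D -> D <= (l - A) / (th * (1 - eta)) + B ->
  `|D / ((l - c) / th) - 1| < eps.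
Proof.
move=> th0 eps0 eta0 eta2 eta4 B0 lbig lAc Dlo Dhi.
have [A1 A2] : A <= `|A| /\ - A <= `|A| by rewrite ler_norm -normrN ler_norm.
have [c1 c2] : c <= `|c| /\ - c <= `|c| by rewrite ler_norm -normrN ler_norm.
have A0 := normr_ge0 A; have c0 := normr_ge0 c.
have lA : 0 < l - A by lra.
have lc : 0 < l - c by lra.
have E x : 0 < x -> th * ((l - A) / (th * x)) = (l - A) / x.
  by move=> x0; field; rewrite !gt_eqF.
have eta1 : 0 < 1 - eta by lra.
have eta1' : 0 < 1 + eta by lra.
have lo : (1 - eta) * (l - A) <= th * D.
  apply: (@le_trans _ _ (th * ((l - A) / (th * (1 + eta))))); last by rewrite ler_pM2l.
  rewrite E// ler_pdivlMr//; have := mulr_ge0 (sqr_ge0 eta) (ltW lA); rewrite expr2; lra.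
have hi : th * D <= (1 + 2 * eta) * (l - A) + th * B.
  apply: (@le_trans _ _ (th * ((l - A) / (th * (1 - eta)) + B))); first by rewrite ler_pM2l.
  rewrite mulrDr lerD2r E// ler_pdivrMr//.
  have e2 : 0 <= 1 - 2 * eta by lra.
  have := mulr_ge0 (mulr_ge0 (ltW eta0) e2) (ltW lA); lra.
rewrite invfM invrK mulrA (mulrAC D) (mulrC D) ltr_norml.
have thB : 0 <= th * B by rewrite mulr_ge0// ltW.
have l0 : 0 < l by lra.
have h1 : 4 * (eta * l) <= eps * l by rewrite mulrA ler_pM2r.
have h2 : eps * c <= eps * `|c| by rewrite ler_pM2l.
have h2' : - (eps * c) <= eps * `|c| by rewrite -mulrN ler_pM2l.
have h3 : (1 - eta) * A <= (1 - eta) * `|A| by rewrite ler_pM2l.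
have h4 : (1 + 2 * eta) * - A <= (1 + 2 * eta) * `|A| by rewrite ler_pM2l//; lra.
have h5 : 0 <= eta * `|A| by rewrite mulr_ge0// ltW.
have h6 : 0 <= (1 - 2 * eta) * `|A| by rewrite mulr_ge0//; lra.
apply/andP; split.
  by rewrite ltrBrDr ltr_pdivlMr//; apply: lt_le_trans lo; lra.
by rewrite ltrBlDr ltr_pdivrMr//; apply: le_lt_trans hi _; lra.
Qed.

End Asymptotics.

Section MeanCost.
Context (R : realType) (p : R).
Hypothesis p01 : 0 < p < 1.

Lemma mean_cost_gt0 : 0 < coin p (cost p).
Proof.
have [p0 p1] := andP p01.
by rewrite /coin addr_gt0// mulr_gt0 ?cost_gt0// subr_gt0.
Qed.

(** The difference of the two sides is (1/2 - p)(ln p - ln (1 - p)), whose factors have opposite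
    signs. This makes kappa positive. *)
Lemma mean_cost_lt : p != 1 / 2 -> coin p (cost p) < coin 2^-1 (cost p).
Proof.
have [p0 p1] := andP p01 => p_neq; rewrite /coin /cost.
have q0 : 0 < 1 - p by lra.
have [plt|pgt|pE] := ltgtP p (1 / 2); last by rewrite pE eqxx in p_neq.
- have : ln p < ln (1 - p) by rewrite ltr_ln ?posrE//; lra.
  nra.
- have : ln (1 - p) < ln p by rewrite ltr_ln ?posrE//; lra.
  nra.
Qed.

(** The mean cost of a fair bit is - ln sqrt(p (1 - p)); the factors ln 2 cancel. *)
Lemma log2_ratioE :
  entropy p / log2 (1 / Num.sqrt (p * (1 - p))) = coin p (cost p) / coin 2^-1 (cost p).
Proof.
have [p0 p1] := andP p01; have q0 : 0 < 1 - p by lra.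
have pq0 : 0 < p * (1 - p) by rewrite mulr_gt0.
have ln2 : 0 < ln 2 :> R by rewrite ln_gt0// ltr1n.
have lnsqrt : ln (Num.sqrt (p * (1 - p))) = (ln p + ln (1 - p)) / 2.
  by rewrite -powR12_sqrt ?ltW// ln_powR lnM ?posrE// mulrC.
have lam0 : 0 < coin 2^-1 (cost p).
  rewrite /coin addr_gt0// mulr_gt0 ?cost_gt0//; lra.
rewrite /entropy /log2 div1r lnV ?posrE ?sqrtr_gt0// lnsqrt.
have -> : - ((ln p + ln (1 - p)) / 2) = coin 2^-1 (cost p) by rewrite /coin /cost; field.
have -> : - p * (ln p / ln 2) - (1 - p) * (ln (1 - p) / ln 2) = coin p (cost p) / ln 2.
  by rewrite /coin /cost; field; rewrite gt_eqF.
by field; rewrite !gt_eqF.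
Qed.

End MeanCost.

Lemma normalizationE (R : realType) (k x : R) : 1 < x ->
  log2 (log2 x) / - log2 k = (ln (ln x) - ln (ln 2)) / - ln k.
Proof.
move=> x1; have lnx : 0 < ln x by rewrite ln_gt0.
have ln2 : 0 < ln 2 :> R by rewrite ln_gt0// ltr1n.
rewrite /log2 -ln_div ?posrE//; have [->|k0] := eqVneq (ln k) 0.
  by rewrite mul0r !oppr0 invr0 !mulr0.
by field; rewrite k0 gt_eqF.
Qed.

(** * Choice of the constants and the typical depth *)

Section Typical.
Context (R : realType) (p alpha : R).
Hypothesis p01 : 0 < p < 1.
Hypothesis alpha01 : 0 < alpha < 1.
Hypothesis p_neq : p != 1 / 2.

Lemma typical_depth (eps delta : R) : 0 < eps -> 0 < delta ->
  exists n0, forall n, (n0 <= n)%N -> exists M (bad : pred (seq (seq bool))),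
    iid (iid (coin p) M) n (fun us => (bad us)%:R) <= delta /\
    forall (s0 : bstring) ss (S : {fset bstring}), (size ss).+1 = n ->
      (forall z, (z \in S) = (z \in s0 :: ss)) ->
      ~~ bad [seq mkseq z M | z <- s0 :: ss] ->
      `|(depth_from alpha S s0 0)%:R / ((ln (ln n%:R) - ln (ln 2)) /
         - ln (1 - coin p (cost p) / coin 2^-1 (cost p))) - 1| < eps.
Proof.
move=> eps0 delta0; have [a0 a1] := andP alpha01.
have h0 := mean_cost_gt0 p01; have hlam := mean_cost_lt p01 p_neq.
set h := coin p (cost p) in h0 hlam *; set lam := coin 2^-1 (cost p) in hlam *.
set th := - ln (1 - h / lam).
have lam0 := lt_trans h0 hlam.
have t0 : 0 < h / lam by rewrite divr_gt0.
have t1 : h / lam < 1 by rewrite ltr_pdivrMr// mul1r.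
have kap0 : 0 < 1 - h / lam by rewrite subr_gt0.
have th0 : 0 < th by rewrite oppr_gt0 ln_lt0//; apply/andP; split; lra.
have kapE : 1 - h / lam = expR (- th) by rewrite /th opprK lnK.
pose eta := Num.min 2^-1 (eps / 4).
have eta0 : 0 < eta by rewrite lt_min; apply/andP; split; lra.
have eta2 : eta <= 2^-1 by rewrite ge_min lexx.
have eta4 : 4 * eta <= eps by rewrite mulrC -ler_pdivlMr// ge_min lexx orbT.
(* These are kappa^(1 + eta) and kappa^(1 - eta): as contraction factors they change the number of
   nodes by a relative error of order eta. *)
pose k1 := expR (- (th * (1 + eta))); pose k2 := expR (- (th * (1 - eta))).
have k1k2 : k1 < 1 - h / lam < k2.
  rewrite kapE !ltr_expR !ltrN2.
  by have := mulr_gt0 th0 eta0 => ?; apply/andP; split; lra.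
have [rho1 [rho2 [hm1 [hm2 [[r10 r1l r20 r2l] [hm10 hm1l hm2l k2E k1E]]]]]] :=
  rates h0 hlam k1k2.
have hm20 : 0 < hm2 := lt_trans h0 hm2l.
pose dk := 1 - rho2 * hm2 - k1.
have dk0 : 0 < dk by rewrite subr_gt0.
(* y0 >= hm2 / dk keeps the rounding term hm2 / y0 within the slack dk. *)
have [y0 [Y0y y00 small]] :=
  exceptional_small p01 alpha01 r10 r1l r20 r2l hm1l hm2l (hm2 / dk) delta0.
have g0 := min_cost_gt0 p01; set g := min_cost p in g0.
pose r := (Num.truncn (2 * y0 / g)).+1.
have rE : 2 * y0 <= r%:R * g by rewrite -ler_pdivrMr// ltW// truncnS_gt.
(* In B, r nodes cross the window |y| < y0 and one comes from rounding j up. *)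
pose A := ln y0; pose B : R := 1 + r%:R; pose c : R := ln (ln 2).
pose l0 := `|A| + `|c| + (2 * `|A| + th * B + (1 + eps) * `|c|) * 2 / eps + 1.
exists (Num.truncn (expR (expR l0))).+2 => n n0n.
have ntE : expR (expR l0) < n%:R.
  by apply: (lt_le_trans (truncnS_gt _)); rewrite ler_nat ltnW.
have n2 : (1 < n)%N by apply: leq_trans n0n.
have n_gt1 : 1 < n%:R :> R by rewrite ltr1n.
pose L : R := ln n%:R.
have L0 : 0 < L by rewrite ln_gt0.
have lL : l0 < ln L.
  rewrite -[ltLHS]expRK ltr_ln ?posrE ?expR_gt0//.
  by rewrite -[ltLHS]expRK ltr_ln ?posrE ?expR_gt0// (lt_trans _ n_gt1).
have C0 : 0 <= (2 * `|A| + th * B + (1 + eps) * `|c|) * 2.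
  have B0 : 0 <= B by rewrite addr_ge0.
  by rewrite mulr_ge0// !addr_ge0// mulr_ge0//; lra.
have [M0 HM0] : exists M0, forall M, (M0 <= M)%N -> iid (iid (coin p) M) n (fun us =>
    (exceptional p alpha rho1 rho2 hm1 hm2 y0 M us)%:R) <= delta.
  by rewrite -(prednK (ltnW n2)); apply: small; rewrite -ltnS prednK// ltnW.
(* M0 makes exceptional samples rare; L / g brings y down to 0 by level M. *)
pose M := maxn M0 (Num.truncn (L / g)).+1.
exists M, (exceptional p alpha rho1 rho2 hm1 hm2 y0 M).
split; first by apply: HM0; rewrite leq_maxl.
move=> s0 ss S ssn SE ord.
have words_uniq : uniq (mkseq s0 M :: [seq mkseq z M | z <- ss]).
  by move: ord; rewrite negb_or negbK => /andP[].
have k10 : 0 < k1 := expR_gt0 _.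
have k20 : 0 < k2 := expR_gt0 _.
have k1E' : k1 <= 1 - rho2 * hm2 - hm2 / y0.
  have : hm2 / y0 <= dk by rewrite ler_pdivrMr// mulrC -ler_pdivrMr.
  by rewrite /dk; lra.
have M_large : ln (size ss).+1%:R <= min_cost p * M%:R.
  rewrite ssn mulrC -ler_pdivrMr//; apply: (le_trans (ltW (truncnS_gt _))).
  by rewrite ler_nat leq_maxr.
have yE : log_remaining p (size ss) (mkseq s0 0) = L.
  by rewrite /log_remaining /self_info big_nil subr0 ssn.
have lo j := ordinary_depth_ge p01 a0 SE words_uniq y00 r20 hm10 hm20 k2E k1E' M_large
  ord (ltW a1) k10 (j := j) (m := 0%N).
have hi j := ordinary_depth_le p01 a0 SE words_uniq y00 r20 hm10 hm20 k2E k1E' M_large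
  ord (ltW a1) k20 (j := j) (m := 0%N) rE.
rewrite /= yE in lo hi.
have l0A : `|A| + `|c| < l0.
  by rewrite /l0 -addrA ltrDl ltr_wpDl// divr_ge0// ltW.
have A_le : A <= `|A| by exact: ler_norm.
have lA : 0 < ln L - A by have := normr_ge0 c; lra.
(* On the logarithmic scale each node subtracts th (1 + eta) or th (1 - eta) from ln L, and j is
   chosen so that ln y0 is reached. *)
have powE (x : R) j : 0 < x -> expR (- (th * x)) ^+ j * L = expR (ln L - j%:R * (th * x)).
  by move=> x0; rewrite -expRM_natl addrC expRD lnK ?posrE// mulrN.
apply: (@depth_ratio _ th eta eps A B c (ln L)) => //.
- by rewrite addr_ge0.
- rewrite -ltr_pdivrMl//; apply: le_lt_trans lL; rewrite /l0 [leLHS]mulrC.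
  have := normr_ge0 A; have := normr_ge0 c; lra.
- exact: lt_trans lL.
- set x := (ln L - A) / _.
  have e1 : 0 < th * (1 + eta) by rewrite mulr_gt0//; lra.
  have x0 : 0 <= x by rewrite divr_ge0// ltW.
  apply: (le_trans (ltW (truncnS_gt x))); rewrite ler_nat; apply: lo.
  rewrite powE; last by lra.
  rewrite -[leLHS](lnK (_ : y0 \in Num.pos)) ?posrE// ler_expR -/A.
  have : (Num.truncn x)%:R <= x by rewrite truncn_le.
  by rewrite ler_pdivlMr//; lra.
- set x := (ln L - A) / _.
  have e1 : 0 < th * (1 - eta) by rewrite mulr_gt0//; lra.
  have x0 : 0 <= x by rewrite divr_ge0// ltW.
  have : (depth_from alpha S s0 0 <= (Num.truncn x).+1 + r)%N.
    apply: hi; rewrite powE; last by lra.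
    rewrite -[ltRHS](lnK (_ : y0 \in Num.pos)) ?posrE// ltr_expR -/A.
    have : x < (Num.truncn x).+1%:R by exact: truncnS_gt.
    by rewrite ltr_pdivrMr//; lra.
  rewrite -(ler_nat R) => /le_trans; apply.
  have : (Num.truncn x)%:R <= x by rewrite truncn_le.
  by rewrite natrD -natr1 /B; lra.
Qed.

End Typical.

(** * The random index and the limit *)

Section Union.
Context (d : measure_display) (T : measurableType d) (R : realType).
Variables (P : probability T R) (n : nat) (J : {RV P >-> nat}).
Hypothesis n_gt0 : (0 < n)%N.
Hypothesis J_law : forall k : nat, (k < n)%N -> P [set w | J w = k] = (n%:R^-1)%:E.

Lemma index_bound : P [set w | (n <= J w)%N] = 0%E.
Proof.
have mJ k : measurable [set w | J w = k] by exact: measurable_index.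
rewrite (_ : [set w | (n <= J w)%N] = ~` \big[setU/set0]_(k < n) [set w | J w = k]).
  rewrite probability_setC; last by apply: bigsetU_measurable.
  rewrite measure_bigsetU_ord//; last by move=> i j _ _ [w [/= -> /ord_inj]].
  rewrite (eq_bigr (fun=> (n%:R^-1)%:E)); last by move=> k _; exact: J_law.
  rewrite sumEFin sumr_const card_ord -(mulr_natl (n%:R^-1 : R)) divff ?subee//.
  by rewrite pnatr_eq0 -lt0n.
rewrite -(bigcup_mkord n (fun k => [set w | J w = k])).
apply/seteqP; split => w /=; first by move=> nJ [k /= kn Jk]; move: kn; rewrite -Jk ltnNge nJ.
by move=> H; rewrite leqNgt; apply/negP => Jn; apply: H; exists (J w).
Qed.

(** Each [B k] carries the weight 1 / n of its index, so the union over n indices loses no factor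
    n. *)
Lemma index_union_bound (E : set T) (B : nat -> set T) (e : R) :
  measurable E -> (forall k, (k < n)%N -> measurable (B k)) ->
  (forall w, E w -> (J w < n)%N -> B (J w) w) ->
  (forall k, (k < n)%N -> P (B k) = (n%:R^-1 * e)%:E) ->
  (P E <= e%:E)%E.
Proof.
move=> mE mB EB PB.
have mJn : measurable [set w | (n <= J w)%N].
  exact: (measurable_funPTI (J : {mfun T >-> nat}) (Y := [set k | (n <= k)%N])).
have mU : measurable (\big[setU/set0]_(k < n) B k).
  by apply: bigsetU_measurable => k _; exact: mB.
apply: (@le_trans _ _ (P ([set w | (n <= J w)%N] `|` \big[setU/set0]_(k < n) B k))).
  apply: le_measure; rewrite ?inE//; first exact: measurableU.
  move=> w Ew; have [nJ|Jn] := leqP n (J w); [by left|right].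
  by rewrite -(bigcup_mkord n B); exists (J w) => //; exact: EB.
apply: (@le_trans _ _ (0 + P (\big[setU/set0]_(k < n) B k))%E).
  by rewrite -[X in (X + _)%E]index_bound; exact: measureU2.
rewrite add0e; apply: (le_trans (Boole_inequality _ _)) => //.
rewrite (eq_bigr (fun=> (n%:R^-1 * e)%:E)); last by move=> k _; exact: PB.
by rewrite sumEFin sumr_const card_ord -(mulr_natl (n%:R^-1 * e : R)) mulVKf// pnatr_eq0 -lt0n.
Qed.

End Union.

Theorem theorem2 (R : realType) (alpha p : R)
    (alpha_gt0 : 0 < alpha) (alpha_lt1 : alpha < 1)
    (p_gt0 : 0 < p) (p_lt1 : p < 1) (p_neq : p != 1 / 2)
    (d : measure_display) (T : measurableType d) (P : probability T R)
    (xi : nat -> nat -> {RV P >-> bool})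
    (xi_law : forall i j : nat, P [set w | xi i j w = true] = p%:E)
    (xi_indep : mutually_independent P
       (fun ij : nat * nat => sigma_of (xi ij.1 ij.2)))
    (J : nat -> {RV P >-> nat})
    (J_law : forall n k : nat, (k < n)%N ->
       P [set w | J n w = k] = (n%:R^-1)%:E)
    (J_indep : forall n : nat, (0 < n)%N -> mutually_independent P
       (fun o : option ('I_n * nat) =>
          if o is Some ij then sigma_of (xi ij.1 ij.2) else sigma_of (J n))) :
  let q := 1 - p in
  let h := entropy p in
  cvg_in_probability P
    (fun (n : nat) (w : T) =>
       (random_depth alpha (fun i j => xi i j : T -> bool) (J n) n w)%:R /
       (log2 (log2 n%:R) / - log2 (1 - h / log2 (1 / Num.sqrt (p * q)))))
    1.
Proof.
move=> q h eps eps0.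
have p01 : 0 < p < 1 by rewrite p_gt0.
have alpha01 : 0 < alpha < 1 by rewrite alpha_gt0.
pose b i j : T -> bool := xi i j.
have mE n : measurable [set w | eps <= `|(random_depth alpha b (J n) n w)%:R /
    (log2 (log2 n%:R) / - log2 (1 - h / log2 (1 / Num.sqrt (p * q)))) - 1|].
  apply: (@measurable_random_depth _ T R alpha alpha_gt0 (ltW alpha_lt1) b n _ (J n) _
    (fun k => eps <= `|k%:R / (log2 (log2 n%:R) /
      - log2 (1 - h / log2 (1 / Num.sqrt (p * q)))) - 1|)).
    by move=> i j c; exact: measurable_bit.
  by move=> k; exact: measurable_index.
apply/fine_cvgP; split; first by apply: nearW => n; exact: fin_num_measure.
apply/cvgrPdist_le => delta delta0.
have [n0 Hn0] := typical_depth p01 alpha01 p_neq eps0 delta0.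
exists (maxn n0 2) => // n /=; rewrite geq_max => /andP[n0n n2].
have n_gt0 : (0 < n)%N by exact: ltnW.
have [M [bad [bad_le good]]] := Hn0 n n0n.
rewrite sub0r normrN ger0_norm ?fine_ge0 ?measure_ge0//.
rewrite -lee_fin fineK; last exact: fin_num_measure.
apply: le_trans (_ : (iid (iid (coin p) M) n (fun us => (bad us)%:R))%:E <= _)%E; last first.
  by rewrite lee_fin.
(* The followed string comes first, the position that [exceptional] reserves for it. *)
pose idx k := k :: [seq j <- iota 0 n | j != k].
pose B k := [set w | J n w = k /\ bad [seq mkseq z M | z <- map (string_at b w) (idx k)]].
have BE k : (k < n)%N -> measurable (B k) /\
    P (B k) = (n%:R^-1 * iid (iid (coin p) M) n (fun us => (bad us)%:R))%:E.
  move=> kn; pose js : seq 'I_n := Ordinal kn :: [seq j <- enum 'I_n | j != Ordinal kn].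
  have jsE : map val js = idx k.
    apply: (congr1 (cons k)); rewrite -val_enum_ord [RHS]filter_map.
    by apply: (congr1 (map val)); apply: eq_filter.
  have ujs : uniq js by rewrite /= mem_filter eqxx /= filter_uniq ?enum_uniq.
  have sjs : size js = n.
    have /perm_size : perm_eq js (enum 'I_n).
      apply: uniq_perm; rewrite ?enum_uniq// => j; rewrite inE mem_filter mem_enum /= andbT.
      by case: eqP.
    by rewrite size_enum_ord.
  have [] := words_law p01 xi_law (J_law n) (J_indep n n_gt0) M bad ujs kn.
  rewrite sjs; set S := [set w | _] => mS PS; suff -> : B k = S by [].
  apply/seteqP; have E w : [seq [seq xi j t w | t <- iota 0 M] | j : 'I_n <- js] =
      [seq mkseq z M | z <- map (string_at b w) (idx k)] by rewrite -jsE -!map_comp.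
  by split => w -[Jw Hw]; split => //; move: Hw; rewrite E.
apply: (index_union_bound n_gt0 (J_law n) (mE n)).
- by move=> k kn; exact: (BE k kn).1.
- move=> w Ew Jn; split => //; apply: contrapT => /negP nbad.
  suff : `|(random_depth alpha b (J n) n w)%:R / (log2 (log2 n%:R) /
      - log2 (1 - h / log2 (1 / Num.sqrt (p * q)))) - 1| < eps by rewrite ltNge Ew.
  rewrite normalizationE ?ltr1n// /h /q log2_ratioE//.
  rewrite /random_depth -depth_from0.
  apply: (good _ [seq string_at b w j | j <- [seq j <- iota 0 n | j != J n w]]) => //.
    rewrite size_map size_filter -[RHS](size_iota 0 n).
    rewrite -(count_predC (fun j => j != J n w) (iota 0 n)) -addn1; congr addn.
    rewrite (eq_count (a2 := pred1 (J n w))); last by move=> j /=; rewrite negbK.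
    by rewrite count_uniq_mem ?iota_uniq// mem_iota add0n Jn.
  move=> z; rewrite -[_ :: _]/(map (string_at b w) (idx (J n w))).
  apply/in_first_strings/mapP => -[j].
    move=> jn ->; exists j => //; rewrite inE mem_filter mem_iota add0n /= jn andbT.
    by case: eqP.
  rewrite inE mem_filter mem_iota add0n /= => jJ ->; exists j => //.
  by case/orP: jJ => [/eqP ->|/andP[]].
- by move=> k kn; exact: (BE k kn).2.
Qed.
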